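(* Let $B\in 2^\omega$. Then $0'$ is low for random relative to $B$ if and only if $B$ is positive-measure dominating.
   Context: Reals are elements of $2^\omega$; ''positive-measure many $X$'' and ''measure zero'' refer to the uniform (fair-coin) measure on $2^\omega$. $0'$ is the halting problem. A real is $A$-random if it is Martin-Löf random relative to $A$. For $A,B\in 2^\omega$, $A$ is low for random relative to $B$ (written $A\le_{LR}B$) if each $B$-random real is $A$-random. For a Turing functional $\Phi$ (with $\Phi^X$ a partial function from $\omega$ to $\omega$), $\mathrm{Tot}(\Phi)=\{X\in 2^\omega:\Phi^X\text{ is total}\}$. A function $f:\omega\to\omega$ dominates a total function $g:\omega\to\omega$ if $f(n)\ge g(n)$ for all but finitely many $n$. Write $\Phi<B$ if either there exists $f\le_T B$ such that for positive-measure many $X$, $\Phi^X$ is (total and) dominated by $f$, or $\mathrm{Tot}(\Phi)$ has measure zero. $B$ is positive-measure dominating if $\Phi<B$ for each Turing functional $\Phi$. *)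

(* Defs.v *)
From Stdlib Require Export Cantor.
From mathcomp Require Export all_boot all_order all_algebra.
From mathcomp Require Export all_classical all_reals all_analysis.

Set Implicit Arguments.
Unset Strict Implicit.
Unset Printing Implicit Defensive.

Import Order.TTheory GRing.Theory Num.Theory.
Local Open Scope classical_set_scope.

Definition pair_nat (x y : nat) : nat := Cantor.to_nat (x, y).

(** Programs for the partial functions from nat to nat that are partial
    recursive in an oracle; several arguments are packed with [pair_nat]. *)
Inductive program : Set :=
| PZero
| PSucc
| PFst
| PSnd
| POracle
| PPair of program & program
| PComp of program & program
| PPrec of program & program
| PMu of program.

(** [eval X c x y] means that program [c] with oracle [X] halts on input [x]
    with output [y]. A Turing functional Phi is given by a program [c], and
    [eval X c n m] then says that Phi^X(n) converges with value m.
    - [PPrec f g] sends (a, 0) to f(a), and (a, n+1) to g(a, (n, r)) where r is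
      its value at (a, n); below [r] lists the successive values.
    - [PMu f] sends x to the least y such that f(x, y) = 0, provided that
      f(x, z) converges for each z < y. *)
Fixpoint eval (X : cantor_space) (c : program) (x y : nat) : Prop :=
  match c with
  | PZero => y = 0
  | PSucc => y = x.+1
  | PFst => y = (Cantor.of_nat x).1
  | PSnd => y = (Cantor.of_nat x).2
  | POracle => y = nat_of_bool (X x)
  | PPair f g => exists a b, [/\ eval X f x a, eval X g x b & y = pair_nat a b]
  | PComp f g => exists2 z, eval X g x z & eval X f z y
  | PPrec f g =>
      let: (a, n) := Cantor.of_nat x in
      exists r : nat -> nat,
        [/\ eval X f a (r 0),
            forall i, i < n ->
              eval X g (pair_nat a (pair_nat i (r i))) (r i.+1)
          & y = r n]
  | PMu f =>
      eval X f (pair_nat x y) 0 /\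
      forall z, z < y -> exists v, eval X f (pair_nat x z) v.+1
  end.

Definition halts (X : cantor_space) (c : program) (x : nat) : Prop :=
  exists y, eval X c x y.

Definition computes (X : cantor_space) (c : program) (g : nat -> nat) : Prop :=
  forall n, eval X c n (g n).

Definition turing_le (f : nat -> nat) (B : cantor_space) : Prop :=
  exists c, computes B c f.

Fixpoint goedel (c : program) : nat :=
  match c with
  | PZero => pair_nat 0 0
  | PSucc => pair_nat 1 0
  | PFst => pair_nat 2 0
  | PSnd => pair_nat 3 0
  | POracle => pair_nat 4 0
  | PPair f g => pair_nat 5 (pair_nat (goedel f) (goedel g))
  | PComp f g => pair_nat 6 (pair_nat (goedel f) (goedel g))
  | PPrec f g => pair_nat 7 (pair_nat (goedel f) (goedel g))
  | PMu f => pair_nat 8 (goedel f)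
  end.

Lemma pair_nat_inj x y x' y' :
  pair_nat x y = pair_nat x' y' -> x = x' /\ y = y'.
Proof. by move=> /Cantor.to_nat_inj[-> ->]. Qed.

Lemma goedel_inj : injective goedel.
Proof.
elim=> [|||||f IHf g IHg|f IHf g IHg|f IHf g IHg|f IHf]
       [|||||f' g'|f' g'|f' g'|f'] /pair_nat_inj[]// _;
  by [move=> /pair_nat_inj[/IHf-> /IHg->] | move=> /IHf->].
Qed.

(** The halting problem 0': programs are run without an oracle, that is, with
    the empty one. *)
Definition halting_problem : cantor_space :=
  fun e => `[< exists c, goedel c = e /\ halts (fun=> false) c e >].

Definition cylinder (s : seq bool) : set cantor_space :=
  [set X | forall i, i < size s -> X i = nth false s i].

(** The outer measure generated by giving [cylinder s] the weight 2^-|s|. It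
    agrees with the fair-coin measure on all measurable sets; it is applied
    below to Borel sets only. *)
Definition fair_coin (R : realType) (A : set cantor_space) : \bar R :=
  ereal_inf [set (\sum_(0 <= i <oo) (2 ^- size (s i))%R%:E)%E
            | s in [set s : nat -> seq bool
                   | A `<=` \bigcup_i cylinder (s i)]].

(** Bijective numbering of the binary strings. *)
Fixpoint string_num (s : seq bool) : nat :=
  if s is b :: t then (string_num t).*2 + b + 1 else 0.

(** The n-th member of the uniformly Sigma^0_1(A) sequence given by [c]: the
    union of the cylinders of those strings s for which [c] with oracle A halts
    on (n, s). *)
Definition sigma01 (A : cantor_space) (c : program) (n : nat) :
    set cantor_space :=
  \bigcup_(s in [set s | halts A c (pair_nat n (string_num s))]) cylinder s.

Definition ml_test (R : realType) (A : cantor_space) (c : program) : Prop :=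
  forall n, (fair_coin R (sigma01 A c n) <= (2 ^- n)%R%:E)%E.

Definition ml_random (R : realType) (A X : cantor_space) : Prop :=
  forall c, ml_test R A c -> ~ (\bigcap_n sigma01 A c n) X.

Definition low_for_random (R : realType) (A B : cantor_space) : Prop :=
  forall X, ml_random R B X -> ml_random R A X.

Definition Tot (c : program) : set cantor_space :=
  [set X | forall n, halts X c n].

Definition dominates (f g : nat -> nat) : Prop :=
  exists N, forall n, N <= n -> g n <= f n.

Definition functional_below (R : realType) (c : program) (B : cantor_space) :
    Prop :=
  (exists f, turing_le f B /\
    (0 < fair_coin R [set X | exists g, computes X c g /\ dominates f g])%E)
  \/ fair_coin R (Tot c) = 0%E.

Definition positive_measure_dominating (R : realType) (B : cantor_space) :
    Prop :=
  forall c, functional_below R c B.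

(* Main.v *)
Require Import Defs.
From mathcomp Require Import zify ring lra.

(** Both directions go through Pi^0_1 classes of positive measure.

    If [B] is positive-measure dominating and [X] lies in every member [V_n] of
    a Martin-Loef test relative to 0', let [V] collect, for all [k], the reals
    [Y] such that some string of length [k] followed by [Y] is in [V_(2k+3)].
    This class has measure at most 1/2 and contains every tail of [X]. As 0' is
    recursively enumerable, the complement of [V] is [Tot Phi] for the
    functional [Phi] that searches for stages refuting membership in [V].
    A [B]-computable [f] dominating [Phi^Y] for positive-measure many [Y]
    yields, after adding a constant to [f], a Pi^0_1(B) class of positive
    measure disjoint from [V]. A [B]-random real has a tail in each such class
    (Kucera), so [X] is not [B]-random.

    Conversely, if [Tot Phi] has positive measure, then it has a Pi^0_1(0')
    subclass of positive measure, with complement [U]. Suppose that every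
    Pi^0_1(B) class of positive measure meets [U] in positive measure. Forcing
    with such classes builds a real that avoids every Martin-Loef test relative
    to [B] and is a concatenation of minimal strings of [U]; the latter makes it
    not 0'-random. So if 0' is low for random relative to [B], some Pi^0_1(B)
    class of positive measure is contained in [Tot Phi] up to a null set, and by
    compactness [B] computes a function dominating [Phi] on most of it.

    Measures are handled through covers by strings; the string with bits
    [b_0 ... b_(s-1)] is coded by the pair of [s] and [sum_i b_i 2^i]. *)

Set Implicit Arguments.
Unset Strict Implicit.
Unset Printing Implicit Defensive.

Import Order.TTheory GRing.Theory Num.Theory.
Local Open Scope classical_set_scope.

(** * Computable functions *)

Definition p1 (z : nat) : nat := (Cantor.of_nat z).1.
Definition p2 (z : nat) : nat := (Cantor.of_nat z).2.

Lemma p1_pair x y : p1 (pair_nat x y) = x.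
Proof. by rewrite /p1 /pair_nat Cantor.cancel_of_to. Qed.

Lemma p2_pair x y : p2 (pair_nat x y) = y.
Proof. by rewrite /p2 /pair_nat Cantor.cancel_of_to. Qed.

Lemma pair_p z : pair_nat (p1 z) (p2 z) = z.
Proof.
by rewrite /p1 /p2 /pair_nat -surjective_pairing Cantor.cancel_to_of.
Qed.

Lemma of_natE z : Cantor.of_nat z = (p1 z, p2 z).
Proof. by rewrite /p1 /p2 -surjective_pairing. Qed.

Lemma p_le z : p1 z + p2 z <= z.
Proof.
have := Cantor.to_nat_non_decreasing (p1 z) (p2 z).
by rewrite -/(pair_nat _ _) pair_p; lia.
Qed.

Lemma p1_le z : p1 z <= z. Proof. by have := p_le z; lia. Qed.
Lemma p2_le z : p2 z <= z. Proof. by have := p_le z; lia. Qed.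

Lemma eval_fun X c x y y' : eval X c x y -> eval X c x y' -> y = y'.
Proof.
elim: c x y y' => [|||||f IHf g IHg|f IHf g IHg|f IHf g IHg|f IHf] x y y' /=;
  try by move=> -> ->.
- move=> [a [b [fa gb ->]]] [a' [b' [fa' gb' ->]]].
  by rewrite (IHf _ _ _ fa fa') (IHg _ _ _ gb gb').
- move=> [z gz fy] [z' gz' fy'].
  by move: fy'; rewrite -(IHg _ _ _ gz gz') => /(IHf _ _ _ fy).
- case: (Cantor.of_nat x) => a n [r [r0 rS ->]] [r' [r'0 r'S ->]].
  suff: forall i, i <= n -> r i = r' i by apply.
  elim=> [_|i IHi lin]; first exact: IHf r0 r'0.
  apply: IHg (rS i lin) _; rewrite IHi ?(ltnW lin)//; exact: r'S.
- move=> [fy hy] [fy' hy'].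
  case: (ltngtP y y') => // lt.
  + by have [v /(IHf _ _ _ fy)] := hy' _ lt.
  + by have [v /(IHf _ _ _ fy')] := hy _ lt.
Qed.

(** A single program serves all oracles in [S]: [setT] expresses uniformity in the oracle, [[set B]]
    plain computability from [B]. *)
Definition comp (S : set cantor_space) (F : cantor_space -> nat -> nat) :=
  exists c, forall X, S X -> computes X c (F X).

Definition bsum (n : nat) (g : nat -> nat) : nat := \sum_(i < n) g i.

Section Comp.
Variable S : set cantor_space.
Implicit Types F G n a : cantor_space -> nat -> nat.

Lemma comp_ext F G : (forall X, S X -> F X =1 G X) -> comp S F -> comp S G.
Proof. by move=> FG [c cF]; exists c => X SX z; rewrite -FG//; exact: cF. Qed.

Lemma comp_p1 : comp S (fun _ z => p1 z).
Proof. by exists PFst. Qed.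

Lemma comp_p2 : comp S (fun _ z => p2 z).
Proof. by exists PSnd. Qed.

Lemma comp_comp F G : comp S F -> comp S G -> comp S (fun X z => F X (G X z)).
Proof.
move=> [c cF] [d dG]; exists (PComp c d) => X SX z /=.
by exists (G X z); [exact: dG | exact: cF].
Qed.

Lemma comp_pair F G :
  comp S F -> comp S G -> comp S (fun X z => pair_nat (F X z) (G X z)).
Proof.
move=> [c cF] [d dG]; exists (PPair c d) => X SX z /=.
by exists (F X z), (G X z); split; [exact: cF | exact: dG |].
Qed.

Lemma comp_id : comp S (fun _ z => z).
Proof.
by apply: comp_ext (comp_pair comp_p1 comp_p2) => X _ z; exact: pair_p.
Qed.

Lemma comp_p1f F : comp S F -> comp S (fun X z => p1 (F X z)).
Proof. exact: comp_comp comp_p1. Qed.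

Lemma comp_p2f F : comp S F -> comp S (fun X z => p2 (F X z)).
Proof. exact: comp_comp comp_p2. Qed.

Lemma comp_succ F : comp S F -> comp S (fun X z => (F X z).+1).
Proof. by apply: (@comp_comp (fun _ z => z.+1)); exists PSucc. Qed.

Lemma comp_oracle F : comp S F -> comp S (fun X z => nat_of_bool (X (F X z))).
Proof.
by apply: (@comp_comp (fun X z => nat_of_bool (X z))); exists POracle.
Qed.

Lemma comp_const k : comp S (fun _ _ => k).
Proof. by elim: k => [|k IHk]; [exists PZero | exact: comp_succ]. Qed.

(** [PPrec] is run on the pair of the input and the count, so that base value and step can still
    consult the input. *)
Lemma comp_rec n a (g : cantor_space -> nat -> nat -> nat -> nat) :
  comp S n -> comp S a ->
  comp S (fun X w => g X (p1 w) (p1 (p2 w)) (p2 (p2 w))) ->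
  comp S (fun X z => nat_rec (fun=> nat) (a X z) (g X z) (n X z)).
Proof.
move=> cn [ca aP] [cg gP].
suff H : comp S (fun X w => nat_rec (fun=> nat) (a X (p1 w)) (g X (p1 w)) (p2 w)).
  apply: comp_ext (comp_comp H (comp_pair comp_id cn)) => X SX z.
  by rewrite p1_pair p2_pair.
exists (PPrec ca cg) => X SX w /=; rewrite of_natE.
exists (nat_rec (fun=> nat) (a X (p1 w)) (g X (p1 w))); split => //=.
- exact: aP.
- move=> i _; have := gP X SX (pair_nat (p1 w) (pair_nat i
    (nat_rec (fun=> nat) (a X (p1 w)) (g X (p1 w)) i))).
  by rewrite /= !(p1_pair, p2_pair).
Qed.

Lemma comp_iter n a (g : cantor_space -> nat -> nat -> nat) :
  comp S n -> comp S a -> comp S (fun X w => g X (p1 w) (p2 w)) ->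
  comp S (fun X z => iter (n X z) (g X z) (a X z)).
Proof.
move=> cn ca cg.
have := @comp_rec n a (fun X z _ r => g X z r) cn ca.
have H : comp S (fun X w => pair_nat (p1 w) (p2 (p2 w))).
  by apply: comp_pair; [exact: comp_p1 | exact: comp_p2f comp_p2].
move=> /(_ (comp_ext _ (comp_comp cg H))) H1.
apply: comp_ext (H1 _) => [X SX z|X SX z].
  by elim: (n X z) => //= k ->.
by rewrite /= p1_pair p2_pair.
Qed.

Lemma comp_add F G : comp S F -> comp S G -> comp S (fun X z => F X z + G X z).
Proof.
move=> cF cG.
have := @comp_iter G F (fun _ _ r => r.+1) cG cF (comp_succ comp_p2).
by apply: comp_ext => X SX z; elim: (G X z) => [|k /= ->]; rewrite ?addn0 ?addnS.
Qed.

Lemma comp_mul F G : comp S F -> comp S G -> comp S (fun X z => F X z * G X z).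
Proof.
move=> cF cG.
have := @comp_iter G (fun _ _ => 0) (fun X z r => F X z + r) cG (comp_const 0)
  (comp_add (comp_comp cF comp_p1) comp_p2).
by apply: comp_ext => X SX z; elim: (G X z) => [|k /= ->]; rewrite ?muln0 ?mulnS.
Qed.

Lemma comp_exp F G : comp S F -> comp S G -> comp S (fun X z => F X z ^ G X z).
Proof.
move=> cF cG.
have := @comp_iter G (fun _ _ => 1) (fun X z r => F X z * r) cG (comp_const 1)
  (comp_mul (comp_comp cF comp_p1) comp_p2).
by apply: comp_ext => X SX z; elim: (G X z) => [|k /= ->]; rewrite ?expn0 ?expnS.
Qed.

Lemma comp_pred F : comp S F -> comp S (fun X z => (F X z).-1).
Proof.
move=> cF.
have := @comp_rec F (fun _ _ => 0) (fun _ _ i _ => i) cF (comp_const 0)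
  (comp_p1f comp_p2).
by apply: comp_ext => X SX z; case: (F X z).
Qed.

Lemma comp_sub F G : comp S F -> comp S G -> comp S (fun X z => F X z - G X z).
Proof.
move=> cF cG.
have := @comp_iter G F (fun _ _ r => r.-1) cG cF (comp_pred comp_p2).
by apply: comp_ext => X SX z; elim: (G X z) => [|k /= ->]; rewrite ?subn0 ?subnS.
Qed.

Lemma comp_neg (b : cantor_space -> nat -> bool) :
  comp S (fun X z => nat_of_bool (b X z)) ->
  comp S (fun X z => nat_of_bool (~~ b X z)).
Proof.
move=> cb; apply: comp_ext (comp_sub (comp_const 1) cb) => X SX z.
by case: (b X z).
Qed.

Lemma comp_and (b b' : cantor_space -> nat -> bool) :
  comp S (fun X z => nat_of_bool (b X z)) ->
  comp S (fun X z => nat_of_bool (b' X z)) ->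
  comp S (fun X z => nat_of_bool (b X z && b' X z)).
Proof.
move=> cb cb'; apply: comp_ext (comp_mul cb cb') => X SX z.
by rewrite mulnb.
Qed.

Lemma comp_or (b b' : cantor_space -> nat -> bool) :
  comp S (fun X z => nat_of_bool (b X z)) ->
  comp S (fun X z => nat_of_bool (b' X z)) ->
  comp S (fun X z => nat_of_bool (b X z || b' X z)).
Proof.
move=> cb cb'.
apply: comp_ext (comp_neg (comp_and (comp_neg cb) (comp_neg cb'))) => X SX z.
by rewrite negb_and !negbK.
Qed.

Lemma comp_leq F G :
  comp S F -> comp S G -> comp S (fun X z => nat_of_bool (F X z <= G X z)).
Proof.
move=> cF cG.
apply: comp_ext (comp_sub (comp_const 1) (comp_sub cF cG)) => X SX z.
by rewrite /leq; case: (F X z - G X z).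
Qed.

Lemma comp_eq F G :
  comp S F -> comp S G -> comp S (fun X z => nat_of_bool (F X z == G X z)).
Proof.
move=> cF cG.
apply: comp_ext (comp_and (comp_leq cF cG) (comp_leq cG cF)) => X SX z.
by rewrite -eqn_leq.
Qed.

Lemma comp_sum n (g : cantor_space -> nat -> nat -> nat) :
  comp S n -> comp S (fun X w => g X (p1 w) (p2 w)) ->
  comp S (fun X z => bsum (n X z) (g X z)).
Proof.
move=> cn cg.
have H : comp S (fun X w => pair_nat (p1 w) (p1 (p2 w))).
  by apply: comp_pair; [exact: comp_p1 | exact: comp_p1f comp_p2].
have := @comp_rec n (fun _ _ => 0) (fun X z i r => g X z i + r) cn (comp_const 0).
move=> /(_ (comp_ext _ (comp_add (comp_comp cg H) (comp_p2f comp_p2)))) H1.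
apply: comp_ext (H1 _) => X SX z; last by rewrite p1_pair p2_pair.
rewrite /bsum; elim: (n X z) => [|k IHk]; rewrite ?big_ord0//.
by rewrite big_ord_recr /= IHk addnC.
Qed.

End Comp.

(** * Bounded quantifiers, division and coded lists *)

Definition bex (n : nat) (p : nat -> bool) : bool := has p (iota 0 n).

Lemma bexP n (p : nat -> bool) : reflect (exists2 i, i < n & p i) (bex n p).
Proof.
apply: (iffP hasP) => [[i]|[i ltin pi]].
  by rewrite mem_iota add0n => /andP[_ ltin] pi; exists i.
by exists i; rewrite ?mem_iota.
Qed.

Lemma bex_sum n (p : nat -> bool) : bex n p = (0 < \sum_(i < n) nat_of_bool (p i)).
Proof.
rewrite lt0n sum_nat_eq0 negb_forall.
apply/bexP/existsP => [[i ltin pi]|[i]].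
  by exists (Ordinal ltin); rewrite /= pi.
by rewrite /= eqb0 negbK => pi; exists i.
Qed.

Lemma eq_bex n (p q : nat -> bool) : (forall i, i < n -> p i = q i) -> bex n p = bex n q.
Proof.
by move=> pq; apply: eq_in_has => i; rewrite mem_iota add0n => /andP[_ /pq].
Qed.

Definition ball (n : nat) (p : nat -> bool) : bool := ~~ bex n (fun i => ~~ p i).

Lemma ballP n (p : nat -> bool) : reflect (forall i, i < n -> p i) (ball n p).
Proof.
apply: (iffP idP) => [/bexP np i ltin|H].
  by apply/negPn/negP => npi; apply: np; exists i.
by apply/bexP => -[i /H->].
Qed.

Lemma sum_ltn n q : \sum_(i < n) (i < q : nat) = minn n q.
Proof.
by elim: n => [|n IHn]; rewrite ?big_ord0 ?big_ord_recr /= ?IHn; lia.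
Qed.

Section Comp2.
Variable S : set cantor_space.
Implicit Types F G n a : cantor_space -> nat -> nat.

Lemma comp_bex n (p : cantor_space -> nat -> nat -> bool) :
  comp S n -> comp S (fun X w => nat_of_bool (p X (p1 w) (p2 w))) ->
  comp S (fun X z => nat_of_bool (bex (n X z) (p X z))).
Proof.
move=> cn cp.
have := comp_sum (g := fun X z i => nat_of_bool (p X z i)) cn cp.
move=> /(comp_leq (comp_const S 1)); apply: comp_ext => X SX z.
by rewrite bex_sum.
Qed.

Lemma comp_ball n (p : cantor_space -> nat -> nat -> bool) :
  comp S n -> comp S (fun X w => nat_of_bool (p X (p1 w) (p2 w))) ->
  comp S (fun X z => nat_of_bool (ball (n X z) (p X z))).
Proof.
move=> cn cp; apply: comp_neg.
by apply: (comp_bex (p := fun X z i => ~~ p X z i)) => //; exact: comp_neg.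
Qed.

(** The quotient counts the [i] below [F] with [(i + 1) * G <= F]; the factor [1 <= G] produces the
    conventional value 0 for a zero divisor. *)
Lemma comp_div F G : comp S F -> comp S G -> comp S (fun X z => F X z %/ G X z).
Proof.
move=> cF cG.
have c1 : comp S (fun X z => \sum_(i < F X z) nat_of_bool (i.+1 * G X z <= F X z)).
  apply: (comp_sum (g := fun X z i => nat_of_bool (i.+1 * G X z <= F X z))) => //.
  by apply: comp_leq; [apply: comp_mul; [exact/comp_succ/comp_p2|] |];
    apply: comp_comp (comp_p1 S).
apply: comp_ext (comp_mul (comp_leq (comp_const S 1) cG) c1) => X SX z.
case: (posnP (G X z)) => [->|d_gt0]; first by rewrite divn0.
rewrite mul1n.
under eq_bigr do rewrite -leq_divRL//.
by rewrite sum_ltn; apply/minn_idPr; exact: leq_div.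
Qed.

Lemma comp_mod F G : comp S F -> comp S G -> comp S (fun X z => F X z %% G X z).
Proof.
move=> cF cG; apply: comp_ext (comp_sub cF (comp_mul (comp_div cF cG) cG)).
by move=> X SX z; rewrite {1}(divn_eq (F X z) (G X z)) addKn.
Qed.

Lemma comp_odd F : comp S F -> comp S (fun X z => nat_of_bool (odd (F X z))).
Proof.
move=> cF; apply: comp_ext (comp_mod cF (comp_const S 2)) => X SX z.
by rewrite modn2.
Qed.

End Comp2.

Lemma comp2 S (g : cantor_space -> nat -> nat -> nat) F G :
  comp S (fun X w => g X (p1 w) (p2 w)) -> comp S F -> comp S G ->
  comp S (fun X z => g X (F X z) (G X z)).
Proof.
move=> cg cF cG; apply: comp_ext (comp_comp cg (comp_pair cF cG)) => X SX z.
by rewrite p1_pair p2_pair.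
Qed.

Definition testbit (j i : nat) : bool := odd (j %/ 2 ^ i).
(** Entry [i] of the list coded by [w]: 0 is the empty list, and the successor of a pair holds head
    and tail. *)
Definition nthc (w i : nat) : nat := p1 (iter i (fun r => p2 r.-1) w).-1.

Lemma comp_testbit S F G :
  comp S F -> comp S G -> comp S (fun X z => nat_of_bool (testbit (F X z) (G X z))).
Proof.
move=> cF cG; apply: comp_odd; apply: comp_div => //; apply: comp_exp => //.
exact: comp_const.
Qed.

Lemma comp_nthc S F G :
  comp S F -> comp S G -> comp S (fun X z => nthc (F X z) (G X z)).
Proof.
move=> cF cG; apply/comp_p1f/comp_pred/comp_iter => //.
exact/comp_p2f/comp_pred/comp_p2.
Qed.

(** A hook, rebound later to cover [cnt], [pre], [cert] and the like. *)
Ltac comp_hook := fail.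

Ltac comp_step :=
  first
  [ assumption
  | exact: comp_const
  | exact: comp_id
  | exact: comp_p1
  | exact: comp_p2
  | lazymatch goal with
    | |- comp _ (fun X z => nthc (@?a X z) (@?b X z)) => refine (@comp_nthc _ a b _ _)
    | |- comp _ (fun X z => nat_of_bool (testbit (@?a X z) (@?b X z))) =>
        refine (@comp_testbit _ a b _ _)
    | |- comp _ (fun X z => pair_nat (@?a X z) (@?b X z)) => refine (@comp_pair _ a b _ _)
    | |- comp _ (fun X z => p1 (@?a X z)) => refine (@comp_p1f _ a _)
    | |- comp _ (fun X z => p2 (@?a X z)) => refine (@comp_p2f _ a _)
    | |- comp _ (fun X z => nat_of_bool (X (@?a X z))) => refine (@comp_oracle _ a _)
    | |- comp _ (fun X z => (@?a X z).+1) => refine (@comp_succ _ a _)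
    | |- comp _ (fun X z => (@?a X z).-1) => refine (@comp_pred _ a _)
    | |- comp _ (fun X z => @?a X z + @?b X z) => refine (@comp_add _ a b _ _)
    | |- comp _ (fun X z => @?a X z - @?b X z) => refine (@comp_sub _ a b _ _)
    | |- comp _ (fun X z => @?a X z * @?b X z) => refine (@comp_mul _ a b _ _)
    | |- comp _ (fun X z => @?a X z ^ @?b X z) => refine (@comp_exp _ a b _ _)
    | |- comp _ (fun X z => @?a X z %/ @?b X z) => refine (@comp_div _ a b _ _)
    | |- comp _ (fun X z => @?a X z %% @?b X z) => refine (@comp_mod _ a b _ _)
    | |- comp _ (fun X z => nat_of_bool (~~ @?a X z)) => refine (@comp_neg _ a _)
    | |- comp _ (fun X z => nat_of_bool (@?a X z && @?b X z)) => refine (@comp_and _ a b _ _)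
    | |- comp _ (fun X z => nat_of_bool (@?a X z || @?b X z)) => refine (@comp_or _ a b _ _)
    | |- comp _ (fun X z => nat_of_bool (@?a X z <= @?b X z)) => refine (@comp_leq _ a b _ _)
    | |- comp _ (fun X z => nat_of_bool (@?a X z == @?b X z)) => refine (@comp_eq _ a b _ _)
    | |- comp _ (fun X z => nat_of_bool (odd (@?a X z))) => refine (@comp_odd _ a _)
    | |- comp _ (fun X z => nat_of_bool (bex (@?n X z) (@?p X z))) => refine (@comp_bex _ n p _ _)
    | |- comp _ (fun X z => nat_of_bool (ball (@?n X z) (@?p X z))) => refine (@comp_ball _ n p _ _)
    | |- comp _ (fun X z => bsum (@?n X z) (@?g X z)) => refine (@comp_sum _ n g _ _)
    | |- comp _ (fun X z => iter (@?n X z) (@?g X z) (@?a X z)) => refine (@comp_iter _ n a g _ _ _)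
    | H : comp _ (fun X w => nat_of_bool (?q X (p1 w) (p2 w)))
      |- comp _ (fun X z => nat_of_bool (?q X (@?a X z) (@?b X z))) =>
        refine (@comp2 _ (fun X w v => nat_of_bool (q X w v)) a b _ _ _)
    | H : comp _ (fun X w => nat_of_bool (?q (p1 w) (p2 w)))
      |- comp _ (fun X z => nat_of_bool (?q (@?a X z) (@?b X z))) =>
        refine (@comp2 _ (fun X w v => nat_of_bool (q w v)) a b _ _ _)
    | H : comp _ (fun _ => ?a) |- comp _ (fun X z => ?a (@?t X z)) =>
        refine (@comp_comp _ (fun _ => a) t _ _)
    | H : comp _ ?a |- comp _ (fun X z => ?a X (@?t X z)) => refine (@comp_comp _ a t H _)
    end
  | comp_hook ].

Ltac comp_tac := repeat (comp_step; cbv beta).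

(** [PMu] looks for a zero, so it runs on the negation of [r]. The search may fail, which is how
    partial functionals arise below. *)
Lemma mu_program S (r : cantor_space -> nat -> nat -> bool) :
  comp S (fun X w => nat_of_bool (r X (p1 w) (p2 w))) ->
  exists c, forall X, S X -> forall z y,
    eval X c z y <-> r X z y /\ (forall y', y' < y -> ~~ r X z y').
Proof.
move=> /comp_neg[c cP]; exists (PMu c) => X SX z y /=.
have H y' : eval X c (pair_nat z y') (~~ r X z y').
  by have := cP X SX (pair_nat z y'); rewrite p1_pair p2_pair.
split=> [[/(eval_fun (H y)) ry yP]|[ry yP]].
  split=> [|y' /yP [v /(eval_fun (H y'))]]; first by case: (r X z y) ry.
  by case: (r X z y').
split=> [|y' /yP ry']; first by have := H y; rewrite ry.
by exists 0; have := H y'; rewrite ry'.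
Qed.

Lemma comp_mu S (r : cantor_space -> nat -> nat -> bool) (f : cantor_space -> nat -> nat) :
  comp S (fun X w => nat_of_bool (r X (p1 w) (p2 w))) ->
  (forall X, S X -> forall z, r X z (f X z)) ->
  (forall X, S X -> forall z y, y < f X z -> ~~ r X z y) ->
  comp S f.
Proof.
move=> /mu_program[c cP] rf rlt; exists c => X SX z.
by apply/(cP X SX); split; [exact: rf | exact: rlt].
Qed.

Lemma nthc_le w i : nthc w i <= w.
Proof.
rewrite /nthc (leq_trans (p1_le _))// (leq_trans (leq_pred _))//.
by elim: i => //= i IHi; rewrite (leq_trans (p2_le _))// (leq_trans (leq_pred _)).
Qed.

Lemma nthc_ex (s : seq nat) : exists w, forall i, i < size s -> nthc w i = nth 0 s i.
Proof.
exists (foldr (fun x r => (pair_nat x r).+1) 0 s).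
elim: s => // x s IHs [|i] /= lti; rewrite /nthc; first by rewrite /= p1_pair.
by rewrite iterSr /= p2_pair -IHs.
Qed.

(** * Certificates of computations *)

(** A certificate of a computation lists entries that follow from earlier ones.
    The entry [ev e x y] claims that the program numbered [e] sends [x] to [y],
    and [code e] only that [e] numbers a program; the latter is needed because
    [PPrec f g] does not run [g] when the recursion argument is 0. Below, [hs p]
    stands for the existence of an earlier entry with property [p]. *)
Definition ev (e x y : nat) : nat := pair_nat e (pair_nat x y).+1.
Definition code (e : nat) : nat := pair_nat e 0.
Definition arg (E : nat) : nat := p1 (p2 E).-1.
Definition res (E : nat) : nat := p2 (p2 E).-1.
Definition isev (E e x : nat) : bool := (E == ev e x (res E)).

Definition code_step (hs : (nat -> bool) -> bool) (t d : nat) : bool :=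
  ((t <= 4) && (d == 0)) ||
  ((5 <= t) && (t <= 7) && hs (fun E => E == code (p1 d)) && hs (fun E => E == code (p2 d))) ||
  ((t == 8) && hs (fun E => E == code d)).

(** The disjuncts follow the tags of [goedel]. Tag 7 has two: at a positive recursion argument the
    same [e] must already have a value at the predecessor. *)
Definition ev_step (q : nat -> bool) (hs : (nat -> bool) -> bool) (e t d x y : nat) : bool :=
  ((t == 0) && (d == 0) && (y == 0)) ||
  ((t == 1) && (d == 0) && (y == x.+1)) ||
  ((t == 2) && (d == 0) && (y == p1 x)) ||
  ((t == 3) && (d == 0) && (y == p2 x)) ||
  ((t == 4) && (d == 0) && (y == nat_of_bool (q x))) ||
  ((t == 5) && hs (fun E => E == ev (p1 d) x (p1 y)) && hs (fun E => E == ev (p2 d) x (p2 y))) ||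
  ((t == 6) && hs (fun E => isev E (p2 d) x && hs (fun E' => E' == ev (p1 d) (res E) y))) ||
  ((t == 7) && (p2 x == 0) && hs (fun E => E == ev (p1 d) (p1 x) y) &&
    hs (fun E => E == code (p2 d))) ||
  ((t == 7) && (1 <= p2 x) &&
    hs (fun E => isev E e (pair_nat (p1 x) (p2 x).-1) &&
      hs (fun E' => E' == ev (p2 d) (pair_nat (p1 x) (pair_nat (p2 x).-1 (res E))) y))) ||
  ((t == 8) && hs (fun E => E == ev d (pair_nat x y) 0) &&
    ball y (fun z => hs (fun E => isev E d (pair_nat x z) && (1 <= res E)))).

Definition step (q : nat -> bool) (hs : (nat -> bool) -> bool) (E : nat) : bool :=
  ((p2 E == 0) && code_step hs (p1 (p1 E)) (p2 (p1 E))) ||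
  ((1 <= p2 E) && ev_step q hs (p1 E) (p1 (p1 E)) (p2 (p1 E)) (arg E) (res E)).

Definition check (q : nat -> bool) (n w : nat) : bool :=
  ball n (fun i => step q (fun p => bex i (fun k => p (nthc w k))) (nthc w i)).

(** [W] packs the output, the number of entries and the list of entries; hence [p1 W] is the
    output. *)
Definition cert (q : nat -> bool) (e x W : nat) : bool :=
  check q (p1 (p2 W)) (p2 (p2 W)) &&
  bex (p1 (p2 W)) (fun k => nthc (p2 (p2 W)) k == ev e x (p1 W)).

Lemma comp_cert S (q : cantor_space -> nat -> nat -> bool) e x W :
  comp S (fun X w => nat_of_bool (q X (p1 w) (p2 w))) ->
  comp S e -> comp S x -> comp S W ->
  comp S (fun X z => nat_of_bool (cert (q X z) (e X z) (x X z) (W X z))).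
Proof.
move=> cq ce cx cW; rewrite /cert /check /step /code_step /ev_step /isev /ev /code /arg /res.
comp_tac.
Qed.

Lemma arg_ev e x y : arg (ev e x y) = x.
Proof. by rewrite /arg /ev p2_pair /= p1_pair. Qed.

Lemma res_ev e x y : res (ev e x y) = y.
Proof. by rewrite /res /ev p2_pair /= p2_pair. Qed.

Lemma isev_ev e x y : isev (ev e x y) e x.
Proof. by rewrite /isev res_ev. Qed.

Definition hasl (l : seq nat) (p : nat -> bool) : bool := has p l.

Lemma hasl_eq l E : hasl l (fun E' => E' == E) = (E \in l).
Proof. by rewrite /hasl -(has_pred1 E); apply: eq_has. Qed.

(** The program is rebuilt from those found for the earlier entries; [goedel_inj] identifies two
    programs found for the same number. *)
Lemma step_sound (X : cantor_space) l E :
  (forall E', E' \in l -> exists c, goedel c = p1 E' /\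
     (0 < p2 E' -> eval X c (arg E') (res E'))) ->
  step X (hasl l) E ->
  exists c, goedel c = p1 E /\ (0 < p2 E -> eval X c (arg E) (res E)).
Proof.
move=> lP.
have codeP e : hasl l (fun E => E == code e) -> exists c, goedel c = e.
  by rewrite hasl_eq => /lP[c [cE _]]; exists c; rewrite cE p1_pair.
have evP e x y : hasl l (fun E => E == ev e x y) ->
    exists2 c, goedel c = e & eval X c x y.
  rewrite hasl_eq => /lP[c [cE]].
  by rewrite p1_pair in cE; rewrite p2_pair arg_ev res_ev => /(_ isT); exists c.
have isevP E' e x : E' \in l -> isev E' e x ->
    exists2 c, goedel c = e & eval X c x (res E').
  by move=> E'l /eqP E'E; apply: evP; rewrite hasl_eq -E'E.
rewrite /step => /orP[/andP[/eqP E0]|/andP[_]].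
  suff: code_step (hasl l) (p1 (p1 E)) (p2 (p1 E)) -> exists c, goedel c = p1 E.
    by move=> H /H[c cE]; exists c; rewrite E0.
  have eE := pair_p (p1 E); have dE := pair_p (p2 (p1 E)); move: eE dE.
  set t := p1 (p1 E); set d := p2 (p1 E) => eE dE.
  case/orP => [/orP[|]|].
  - case/andP=> t4 /eqP d0; move: t4 eE; rewrite d0.
    case: (t) => [|[|[|[|[|]]]]]// _ <-;
    [by exists PZero|by exists PSucc|by exists PFst|by exists PSnd|by exists POracle].
  - case/andP=> /andP[/andP[t5 t7] /codeP[f fE] /codeP[g gE]].
    move: t5 t7 eE; rewrite -dE -fE -gE.
    case: (t) => [|[|[|[|[|[|[|[|]]]]]]]]// _ _ <-;
    [by exists (PPair f g)|by exists (PComp f g)|by exists (PPrec f g)].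
  - by case/andP=> /eqP tE /codeP[f fE]; exists (PMu f); rewrite -eE tE -fE.
suff: ev_step X (hasl l) (p1 E) (p1 (p1 E)) (p2 (p1 E)) (arg E) (res E) ->
    exists c, goedel c = p1 E /\ eval X c (arg E) (res E).
  by move=> H /H[c [cE ecE]]; exists c.
set x := arg E; set y := res E.
have eE := pair_p (p1 E); move: eE.
set e := p1 E; set t := p1 e; set d := p2 e => eE.
have dE := pair_p d.
case/orP => [/orP[/orP[/orP[/orP[/orP[/orP[/orP[/orP[|]|]|]|]|]|]|]|]|].
- by case/andP=> /andP[/eqP tE /eqP d0] /eqP->; exists PZero; rewrite /= -eE tE d0.
- by case/andP=> /andP[/eqP tE /eqP d0] /eqP->; exists PSucc; rewrite /= -eE tE d0.
- by case/andP=> /andP[/eqP tE /eqP d0] /eqP->; exists PFst; rewrite /= -eE tE d0.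
- by case/andP=> /andP[/eqP tE /eqP d0] /eqP->; exists PSnd; rewrite /= -eE tE d0.
- by case/andP=> /andP[/eqP tE /eqP d0] /eqP->; exists POracle; rewrite /= -eE tE d0.
- case/andP=> /andP[/eqP tE /evP[f fE fP]] /evP[g gE gP].
  exists (PPair f g); rewrite /= -eE tE -dE fE gE; split=> //.
  by exists (p1 y), (p2 y); rewrite pair_p.
- case/andP=> /eqP tE /hasP[E1 E1l /andP[/(isevP _ _ _ E1l)[g gE gP] /evP[f fE fP]]].
  by exists (PComp f g); rewrite /= -eE tE -dE fE gE; split=> //; exists (res E1).
- case/andP=> /andP[/andP[/eqP tE /eqP x0] /evP[f fE fP]] /codeP[g gE].
  exists (PPrec f g); rewrite /= -eE tE -dE fE gE of_natE x0; split=> //.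
  by exists (fun=> y).
- case/andP=> /andP[/eqP tE x0] /hasP[E1 E1l /andP[/(isevP _ _ _ E1l)[h hE hP]]].
  case/evP => g gE gP.
  have : exists f, h = PPrec f g.
    move: hE; rewrite -eE tE -dE -gE.
    by case: h {hP} => [|||||f' g'|f' g'|f' g'|f'] /= /pair_nat_inj[]// _
      /pair_nat_inj[_ /goedel_inj->]; exists f'.
  move=> [f hfg]; exists h; split=> //; move: hP; rewrite hfg /= !of_natE.
  rewrite p1_pair p2_pair => -[r [r0 rS rE]].
  (* The values up to the predecessor of the recursion argument are extended by [y]. *)
  exists (fun i => if i <= (p2 x).-1 then r i else y); split=> //=.
  + move=> i; rewrite -{1}(prednK x0) ltnS => ile; rewrite ile.
    case: ltngtP ile => // [lti _|-> _]; first exact: rS.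
    by rewrite -rE.
  + by rewrite leqNgt prednK// leqnn.
- case/andP=> /andP[/eqP tE /evP[f fE fP]] /ballP yP.
  exists (PMu f); rewrite /= -eE tE fE; split=> //; split=> // z zy.
  have /hasP[E1 E1l /andP[/(isevP _ _ _ E1l)[f' f'E f'P] resE]] := yP z zy.
  by exists (res E1).-1; rewrite prednK//; move: f'E f'P; rewrite -fE => /goedel_inj->.
Qed.

Lemma orb_imp (a b a' b' : bool) : (a -> a') -> (b -> b') -> a || b -> a' || b'.
Proof. by move=> H H' /orP[/H->|/H'->]; rewrite ?orbT. Qed.

Lemma andb_imp (a b a' b' : bool) : (a -> a') -> (b -> b') -> a && b -> a' && b'.
Proof. by move=> H H' /andP[/H-> /H'->]. Qed.

(** [hs] occurs only positively in [step]. *)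
Lemma sub_step q (l l' : seq nat) E : {subset l <= l'} -> step q (hasl l) E -> step q (hasl l') E.
Proof.
move=> ll'.
have H (p p' : nat -> bool) : (forall u, p u -> p' u) -> hasl l p -> hasl l' p'.
  by move=> pp' /hasP[u /ll' ul' /pp' pu]; apply/hasP; exists u.
have Hb n (p p' : nat -> bool) : (forall u, p u -> p' u) -> ball n p -> ball n p'.
  by move=> pp' /ballP pn; apply/ballP => i /pn /pp'.
rewrite /step /code_step /ev_step.
by repeat first [exact id | apply: orb_imp | apply: andb_imp | apply: (H) => ? | apply: (Hb) => ?].
Qed.

Lemma step_ev q hs e x y :
  step q hs (ev e x y) = ev_step q hs e (p1 e) (p2 e) x y.
Proof. by rewrite /step arg_ev res_ev /ev p2_pair p1_pair. Qed.

Lemma step_code q hs e : step q hs (code e) = code_step hs (p1 e) (p2 e).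
Proof. by rewrite /step /code p1_pair p2_pair /= orbF. Qed.

Definition valid (q : nat -> bool) (s : seq nat) :=
  forall i, i < size s -> step q (hasl (take i s)) (nth 0 s i).

Lemma valid_cat q s s' : valid q s -> valid q s' -> valid q (s ++ s').
Proof.
move=> vs vs' i; rewrite size_cat take_cat nth_cat => lti.
case: ltnP => [/vs//|les]; apply: sub_step (vs' _ _); last by rewrite ltn_subLR.
by move=> u; rewrite mem_cat => ->; rewrite orbT.
Qed.

Lemma valid_rcons q s E : valid q s -> step q (hasl s) E -> valid q (rcons s E).
Proof.
move=> vs sE i; rewrite size_rcons ltnS leq_eqVlt => /predU1P[->|lti].
  by rewrite -cats1 take_size_cat// nth_cat ltnn subnn.
by rewrite -cats1 nth_cat takel_cat ?lti; [exact: vs | exact: ltnW].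
Qed.

Definition derivable (q : nat -> bool) (E : nat) := exists2 s, valid q s & E \in s.

(** Lists deriving the premises are concatenated, and the new entry comes last. *)
Lemma derivable_step q l E :
  (forall E', E' \in l -> derivable q E') -> step q (hasl l) E -> derivable q E.
Proof.
move=> lD.
have [s vs ls] : exists2 s, valid q s & {subset l <= s}.
  elim: l lD => [|E' l IHl] lD; first by exists [::].
  have [u ul|s vs ls] := IHl; first by apply: lD; rewrite inE ul orbT.
  have [|s' vs' E's'] := lD E'; first by rewrite inE eqxx.
  exists (s' ++ s); first exact: valid_cat.
  by move=> u; rewrite inE mem_cat => /predU1P[->|/ls->]; rewrite ?E's' ?orbT.
move=> /(sub_step ls) sE; exists (rcons s E); first exact: valid_rcons.
by rewrite mem_rcons inE eqxx.
Qed.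

Lemma derivable_code q c : derivable q (code (goedel c)).
Proof.
elim: c => [|||||f IHf g IHg|f IHf g IHg|f IHf g IHg|f IHf];
  try (by apply: (@derivable_step _ [::]); rewrite // step_code [p1 _]p1_pair [p2 _]p2_pair).
1-3: apply: (@derivable_step _ [:: code (goedel f); code (goedel g)]) => [E'|];
  [by rewrite !inE => /orP[]/eqP-> |
   by rewrite step_code /code_step !(p1_pair, p2_pair) !hasl_eq !inE !eqxx ?orbT].
apply: (@derivable_step _ [:: code (goedel f)]) => [E'|]; first by rewrite inE => /eqP->.
by rewrite step_code /code_step !(p1_pair, p2_pair) !hasl_eq !inE !eqxx ?orbT.
Qed.

Lemma derivable_eval (X : cantor_space) c x y :
  eval X c x y -> derivable X (ev (goedel c) x y).
Proof.
elim: c x y => [|||||f IHf g IHg|f IHf g IHg|f IHf g IHg|f IHf] x y /=;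
  try (move=> ->; apply: (@derivable_step _ [::]) => //;
       by rewrite step_ev /ev_step !(p1_pair, p2_pair) /= ?eqxx).
- move=> [a [b [/IHf fa /IHg gb ->]]].
  apply: (@derivable_step _ [:: ev (goedel f) x a; ev (goedel g) x b]) => [E'|].
    by rewrite !inE => /orP[]/eqP->.
  by rewrite step_ev /ev_step !(p1_pair, p2_pair) !hasl_eq !inE !eqxx ?orbT.
- move=> [z /IHg gz /IHf fy].
  apply: (@derivable_step _ [:: ev (goedel g) x z; ev (goedel f) z y]) => [E'|].
    by rewrite !inE => /orP[]/eqP->.
  by rewrite step_ev /ev_step !(p1_pair, p2_pair) /= isev_ev res_ev eqxx !orbT.
- rewrite of_natE => -[r [/IHf r0 rS ->]].
  suff H i : i <= p2 x -> derivable X (ev (pair_nat 7 (pair_nat (goedel f) (goedel g)))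
      (pair_nat (p1 x) i) (r i)) by rewrite -{1}[x]pair_p; exact: H.
  elim: i => [_|i IHi lti].
    apply: (@derivable_step _ [:: ev (goedel f) (p1 x) (r 0); code (goedel g)]) => [E'|].
      by rewrite !inE => /orP[]/eqP->//; exact: derivable_code.
    by rewrite step_ev /ev_step !(p1_pair, p2_pair) !hasl_eq !inE !eqxx ?orbT.
  have /IHg gi := rS i lti.
  apply: (@derivable_step _ [:: ev (pair_nat 7 (pair_nat (goedel f) (goedel g)))
      (pair_nat (p1 x) i) (r i); ev (goedel g) (pair_nat (p1 x) (pair_nat i (r i))) (r i.+1)]).
    by move=> E'; rewrite !inE => /orP[]/eqP->//; apply: IHi; exact: ltnW.
  by rewrite step_ev /ev_step !(p1_pair, p2_pair) /= isev_ev res_ev eqxx !orbT.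
- move=> [/IHf fy yP].
  (* One list must handle all [z < y]; it grows by one entry for each. *)
  have [l lD lP] : exists2 l, (forall E', E' \in l -> derivable X E') &
      (ball y (fun z => hasl l (fun E => isev E (goedel f) (pair_nat x z) && (1 <= res E)))).
    elim: y yP {fy} => [|y IHy] yP; first by exists [::].
    have [l lD /ballP lP] := IHy (fun z zy => yP z (ltnW zy)).
    have [v /IHf fv] := yP y (leqnn _).
    exists (ev (goedel f) (pair_nat x y) v.+1 :: l) => [E'|].
      by rewrite inE => /predU1P[->//|/lD].
    apply/ballP => i; rewrite ltnS leq_eqVlt => /predU1P[->|/lP /= ->]; last by rewrite orbT.
    by rewrite /= isev_ev res_ev.
  apply: (@derivable_step _ (ev (goedel f) (pair_nat x y) 0 :: l)) => [E'|].
    by rewrite inE => /predU1P[->//|/lD].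
  rewrite step_ev /ev_step !(p1_pair, p2_pair) hasl_eq inE eqxx /=.
  rewrite eqxx /=.
  by move/ballP: lP => lP; apply/ballP => i /lP /= ->; rewrite orbT.
Qed.

Lemma check_valid q n w : check q n w <-> valid q (mkseq (nthc w) n).
Proof.
have H i : i < n -> hasl (take i (mkseq (nthc w) n)) =
    (fun p => bex i (fun k => p (nthc w k))).
  move=> lti; apply/funext => p; rewrite /mkseq -map_take take_iota.
  by rewrite (minn_idPl (ltnW lti)) /hasl has_map.
split=> [/ballP nP i|vP]; rewrite ?size_mkseq.
  by move=> lti; rewrite nth_mkseq// H//; exact: nP.
by apply/ballP => i lti; have := vP i; rewrite size_mkseq nth_mkseq// H//; exact.
Qed.

Lemma cert_sound (X : cantor_space) e x W :
  cert X e x W -> exists2 c, goedel c = e & eval X c x (p1 W).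
Proof.
move=> /andP[/check_valid vW] /bexP[k ltk /eqP kE].
set s := mkseq _ _ in vW.
have : nthc (p2 (p2 W)) k \in s by apply: map_f; rewrite mem_iota.
rewrite kE.
have vP E : E \in s -> exists c, goedel c = p1 E /\
     (0 < p2 E -> eval X c (arg E) (res E)).
  move=> /(nthP 0)[i ltis <-]; elim/ltn_ind: i ltis => i IHi ltis.
  apply: step_sound (vW i ltis) => E' /(nthP 0)[j]; rewrite size_take ltis.
  move=> ltj <-; rewrite nth_take//; apply: IHi => //; exact: ltn_trans ltis.
move=> /vP[d [dE]]; rewrite p2_pair arg_ev res_ev => /(_ isT).
by move: dE; rewrite p1_pair; exists d.
Qed.

Lemma cert_complete (X : cantor_space) c x y :
  eval X c x y -> exists2 W, cert X (goedel c) x W & p1 W = y.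
Proof.
move=> /derivable_eval[s vs Es].
have [w wP] := nthc_ex s.
exists (pair_nat y (pair_nat (size s) w)); last by rewrite p1_pair.
rewrite /cert !(p1_pair, p2_pair); apply/andP; split.
  apply/check_valid; suff -> : mkseq (nthc w) (size s) = s by [].
  apply: (@eq_from_nth _ 0) => [|i]; rewrite size_mkseq// => lti.
  by rewrite nth_mkseq// wP.
apply/bexP; exists (index (ev (goedel c) x y) s); first by rewrite index_mem.
by rewrite wP ?index_mem// nth_index.
Qed.

Lemma cert_eval (X : cantor_space) c x W :
  cert X (goedel c) x W -> eval X c x (p1 W).
Proof. by move=> /cert_sound[d /goedel_inj->]. Qed.

Lemma haltsP (X : cantor_space) c x :
  halts X c x <-> exists W, cert X (goedel c) x W.
Proof.
split=> [[y /cert_complete[W]]|[W /cert_eval]]; first by exists W.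
by exists (p1 W).
Qed.

Lemma halting_problemP e :
  halting_problem e <-> exists W, cert (fun=> false) e e W.
Proof.
split=> [/asboolP[c [<- /haltsP]]//|[W /(@cert_sound (fun=> false))[c cE ec]]].
by apply/asboolP; exists c; split=> //; exists (p1 W).
Qed.

(** An oracle query is the argument of an entry with positive second component. It is therefore
    smaller than that entry, which is at most [W]: the number of a certificate bounds its use of the
    oracle. *)
Lemma eq_cert (q q' : nat -> bool) e x W :
  (forall i, i < W -> q i = q' i) -> cert q e x W = cert q' e x W.
Proof.
move=> qq'; congr andb; congr (~~ _); apply: eq_bex => i lti; congr (~~ _).
set E := nthc _ _.
have EW : E <= W by rewrite (leq_trans (nthc_le _ _))// (leq_trans (p2_le _))// p2_le.
rewrite /step; case: posnP => //= E_gt0.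
congr orb; rewrite /ev_step /step qq'//.
rewrite /arg; have := p_le E; have := p_le (p2 E).-1.
by move: E_gt0 EW; lia.
Qed.

(** * Prefixes and strings *)

Definition pre (X : nat -> bool) (s : nat) : nat := bsum s (fun i => X i * 2 ^ i).
Definition cut (a : nat) (X : cantor_space) : cantor_space := fun i => X (a + i).
Definition glue (a : nat) (Z Y : cantor_space) : cantor_space :=
  fun i => if i < a then Z i else Y (i - a).

Lemma bsumS n g : bsum n.+1 g = bsum n g + g n.
Proof. exact: big_ord_recr. Qed.

Lemma bsum0 g : bsum 0 g = 0.
Proof. exact: big_ord0. Qed.

Lemma eq_bsum n g h : (forall i, i < n -> g i = h i) -> bsum n g = bsum n h.
Proof. by move=> gh; apply: eq_bigr => i _; exact: gh. Qed.

Lemma leq_bsum n g h : (forall i, i < n -> g i <= h i) -> bsum n g <= bsum n h.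
Proof. by move=> gh; apply: leq_sum => i _; exact: gh. Qed.

Lemma bsum_add m n g : bsum (m + n) g = bsum m g + bsum n (fun i => g (m + i)).
Proof. by rewrite /bsum big_split_ord. Qed.

Lemma bsumD n g h : bsum n (fun i => g i + h i) = bsum n g + bsum n h.
Proof. exact: big_split. Qed.

Lemma bsumM n c g : bsum n (fun i => c * g i) = c * bsum n g.
Proof. by rewrite /bsum big_distrr. Qed.

Lemma bsum_mul m n g :
  bsum (m * n) g = bsum m (fun i => bsum n (fun j => g (j + n * i))).
Proof.
elim: m => [|m IHm]; first by rewrite !bsum0.
rewrite mulSnr bsum_add IHm bsumS; congr addn.
by apply: eq_bsum => j _; rewrite addnC mulnC.
Qed.

Lemma preS X s : pre X s.+1 = pre X s + X s * 2 ^ s.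
Proof. exact: bsumS. Qed.

Lemma pre_lt X s : pre X s < 2 ^ s.
Proof.
elim: s => [|s IHs]; first by rewrite /pre bsum0.
by rewrite preS expnS; case: (X s) => /=; lia.
Qed.

Lemma eq_pre X Y s : (forall i, i < s -> X i = Y i) -> pre X s = pre Y s.
Proof. by move=> XY; apply: eq_bsum => i /XY ->. Qed.

Lemma pre_add X a m : pre X (a + m) = pre X a + 2 ^ a * pre (cut a X) m.
Proof.
rewrite /pre bsum_add -bsumM; congr addn.
by apply: eq_bsum => i _; rewrite expnD mulnCA.
Qed.

(** As the first bit is the lowest, a prefix is a remainder and what follows it is a quotient. *)
Lemma pre_mod X a s : a <= s -> pre X s %% 2 ^ a = pre X a.
Proof.
move=> /subnKC <-; rewrite pre_add addnC mulnC modnMDl modn_small//.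
exact: pre_lt.
Qed.

Lemma pre_div X a m : pre X (a + m) %/ 2 ^ a = pre (cut a X) m.
Proof.
rewrite pre_add addnC mulnC divnMDl ?expn_gt0// divn_small ?addn0//.
exact: pre_lt.
Qed.

Lemma testbit_pre X s i : i < s -> testbit (pre X s) i = X i.
Proof.
move=> /subnKC <-; rewrite addSnnS /testbit pre_div -add1n pre_add.
by rewrite oddD oddM /= addbF /pre bsumS bsum0 /cut addn0; case: (X i).
Qed.

Lemma pre_testbit j s : pre (testbit j) s = j %% 2 ^ s.
Proof.
elim: s => [|s IHs]; first by rewrite modn1 /pre bsum0.
rewrite preS IHs /testbit expnSr; set q := j %/ 2 ^ s; set r := j %% 2 ^ s.
have -> : j = q./2 * (2 ^ s * 2) + (r + odd q * 2 ^ s).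
  rewrite {1}(divn_eq j (2 ^ s)) -/q -/r -{1}(odd_double_half q) -muln2.
  by ring.
rewrite modnMDl modn_small//.
have : r < 2 ^ s by rewrite ltn_mod expn_gt0.
by case: odd; lia.
Qed.

Lemma pre_eq X Y s i : pre X s = pre Y s -> i < s -> X i = Y i.
Proof. by move=> XY ltis; rewrite -(testbit_pre X ltis) XY testbit_pre. Qed.

Lemma cut_glue a Z Y : cut a (glue a Z Y) = Y.
Proof. by apply/funext => i; rewrite /cut /glue ltnNge leq_addr /= addKn. Qed.

Lemma glue_cut a X : glue a X (cut a X) = X.
Proof. by apply/funext => i; rewrite /cut /glue; case: ltnP => // /subnKC->. Qed.

Lemma pre_glue a Z Y : pre (glue a Z Y) a = pre Z a.
Proof. by apply: eq_pre => i; rewrite /glue => ->. Qed.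

Lemma pre_glue_add a m Z Y : pre (glue a Z Y) (a + m) = pre Z a + 2 ^ a * pre Y m.
Proof. by rewrite pre_add pre_glue cut_glue. Qed.

Lemma cut_cut a b X : cut a (cut b X) = cut (b + a) X.
Proof. by apply/funext => i; rewrite /cut addnA. Qed.

Lemma glue_glue a b Z Z' Y : glue a Z (glue b Z' Y) = glue (a + b) (glue a Z Z') Y.
Proof.
apply/funext => i; rewrite /glue; case: (ltnP i a) => [ia|ai].
  by rewrite ltn_addr.
by rewrite ltn_subLR// subnDA.
Qed.

(** The successor of [string_num s] has in binary the bits of [s], lowest first, below a leading
    1. *)
Lemma string_numE s : (string_num s).+1 = 2 ^ size s + pre (nth false s) (size s).
Proof.
elim: s => [|b s IHs]; first by rewrite /pre bsum0.
rewrite /= -[(size s).+1]add1n pre_add expnD.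
rewrite [pre _ 1]preS /pre bsum0 -/(pre _ _) (_ : cut 1 _ = nth false s)//.
by rewrite expn1 expn0 muln1 /=; lia.
Qed.

Lemma cylinderP s X :
  cylinder s X <-> pre X (size s) = pre (nth false s) (size s).
Proof. by split=> [XP|XP i]; [exact: eq_pre | exact: pre_eq]. Qed.

Lemma string_num_mkseq X m : string_num (mkseq X m) = (2 ^ m + pre X m).-1.
Proof.
have -> : pre X m = pre (nth false (mkseq X m)) m.
  by apply: eq_pre => i lti; rewrite nth_mkseq.
by have := string_numE (mkseq X m); rewrite size_mkseq => <-.
Qed.

(** * Counting strings of a given length, Kraft's inequality, compactness *)

Definition cnt (s : nat) (p : nat -> bool) : nat := bsum (2 ^ s) (fun j => p j : nat).

Lemma eq_cnt s (p q : nat -> bool) : (forall j, j < 2 ^ s -> p j = q j) -> cnt s p = cnt s q.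
Proof. by move=> pq; apply: eq_bsum => j /pq ->. Qed.

Lemma leq_cnt s (p q : nat -> bool) :
  (forall j, j < 2 ^ s -> p j -> q j) -> cnt s p <= cnt s q.
Proof. by move=> pq; apply: leq_bsum => j /pq; case: (p j) => // ->. Qed.

Lemma cntT s : cnt s xpredT = 2 ^ s.
Proof. by rewrite /cnt /bsum sum_nat_const card_ord muln1. Qed.

Lemma cnt_max s p : cnt s p <= 2 ^ s.
Proof. by rewrite -[leqRHS]cntT; exact: leq_cnt. Qed.

Lemma cntID s p q : cnt s p = cnt s (fun j => p j && q j) + cnt s (fun j => p j && ~~ q j).
Proof. by rewrite /cnt -bsumD; apply: eq_bsum => j _; case: (p j); case: (q j). Qed.

Lemma cntC s p : cnt s (fun j => ~~ p j) = 2 ^ s - cnt s p.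
Proof. by rewrite -(cntT s) (cntID s xpredT p) addKn. Qed.

Lemma cntU s (p q : nat -> bool) : cnt s (fun j => p j || q j) <= cnt s p + cnt s q.
Proof.
by rewrite /cnt -bsumD; apply: leq_bsum => j _; case: (p j); case: (q j).
Qed.

Lemma cnt_bex s n (p : nat -> nat -> bool) :
  cnt s (fun j => bex n (p ^~ j)) <= bsum n (fun i => cnt s (p i)).
Proof.
elim: n => [|n IHn].
  by rewrite bsum0 leqn0; apply/eqP/big1 => j _; case: bexP => // -[].
rewrite bsumS (leq_trans _ (leq_add IHn (leqnn _)))// (leq_trans _ (cntU _ _ _))//.
apply: leq_cnt => j _ /bexP[i]; rewrite ltnS leq_eqVlt => /predU1P[-> ->|ltin pi].
  by rewrite orbT.
by apply/orP; left; apply/bexP; exists i.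
Qed.

Lemma cnt_split a m p q :
  cnt (a + m) (fun j => p (j %% 2 ^ a) && q (j %/ 2 ^ a)) = cnt a p * cnt m q.
Proof.
rewrite /cnt expnD mulnC bsum_mul -bsumM; apply: eq_bsum => i _.
rewrite [RHS]mulnC -bsumM; apply: eq_bsum => j ltj.
by rewrite addnC mulnC modnMDl divnMDl ?expn_gt0// modn_small// divn_small// addn0 mulnb andbC.
Qed.

Lemma cnt_mod a s p : a <= s -> cnt s (fun j => p (j %% 2 ^ a)) = cnt a p * 2 ^ (s - a).
Proof.
move=> les; rewrite -(cntT (s - a)) -cnt_split subnKC//.
by apply: eq_cnt => j _; rewrite andbT.
Qed.

Lemma comp_cnt S s (p : cantor_space -> nat -> nat -> bool) :
  comp S s -> comp S (fun X w => nat_of_bool (p X (p1 w) (p2 w))) ->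
  comp S (fun X z => cnt (s X z) (p X z)).
Proof.
move=> cs cp; apply: (comp_sum (g := fun X z i => nat_of_bool (p X z i))) => //.
by comp_tac.
Qed.

Lemma comp_pre S s (q : cantor_space -> nat -> nat -> bool) :
  comp S s -> comp S (fun X w => nat_of_bool (q X (p1 w) (p2 w))) ->
  comp S (fun X z => pre (q X z) (s X z)).
Proof.
move=> cs cq; apply: (comp_sum (g := fun X z i => q X z i * 2 ^ i)) => //.
by comp_tac.
Qed.

(** [mono P] is the closure of [P] under extension and [first P] the prefix-free set of its minimal
    strings; all three generate the same open class. *)
Definition mono (P : nat -> nat -> bool) (s j : nat) : bool :=
  bex s.+1 (fun u => P u (j %% 2 ^ u)).

Definition first (P : nat -> nat -> bool) (s j : nat) : bool :=
  P s j && ~~ bex s (fun u => P u (j %% 2 ^ u)).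

Lemma mono_pre P s X : mono P s (pre X s) <-> exists2 u, u <= s & P u (pre X u).
Proof.
split=> [/bexP[u]|[u leus Pu]]; first by rewrite ltnS => ule; rewrite pre_mod//; exists u.
by apply/bexP; exists u; rewrite ?pre_mod.
Qed.

Lemma mono_mod P s t j : s <= t -> mono P s (j %% 2 ^ s) -> mono P t j.
Proof.
move=> lest /bexP[u]; rewrite ltnS => leus.
rewrite modn_dvdm ?dvdn_exp2l// => Pu.
by apply/bexP; exists u => //; rewrite ltnS (leq_trans leus).
Qed.

Lemma first_ex (P : nat -> nat -> bool) X :
  (exists s, P s (pre X s)) -> exists s, first P s (pre X s).
Proof.
move=> exP; case: (ex_minnP exP) => s Ps smin; exists s; rewrite /first Ps /=.
by apply/negP => /bexP[u ltus]; rewrite (pre_mod _ (ltnW ltus)) => /smin; rewrite leqNgt ltus.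
Qed.

(** Kraft's inequality for the minimal strings. At length [N.+1], a string in [mono P] either
    extends one of length [N] there, which doubles the count, or may be newly minimal. *)
Lemma cnt_first P N :
  bsum N.+1 (fun s => cnt s (first P s) * 2 ^ (N - s)) <= cnt N (mono P N).
Proof.
elim: N => [|N IHN].
  rewrite bsumS bsum0 muln1 add0n; apply: leq_cnt => j; rewrite ltnS leqn0 => /eqP->.
  by case/andP=> P0 _; apply/bexP; exists 0.
rewrite bsumS subnn muln1.
have -> : bsum N.+1 (fun s => cnt s (first P s) * 2 ^ (N.+1 - s)) =
    2 * bsum N.+1 (fun s => cnt s (first P s) * 2 ^ (N - s)).
  by rewrite -bsumM; apply: eq_bsum => i; rewrite ltnS => lei; rewrite subSn// expnS mulnCA.
rewrite (cntID N.+1 (mono P N.+1) (fun j => mono P N (j %% 2 ^ N))).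
rewrite leq_add//.
  rewrite mulnC (leq_trans (leq_mul IHN (leqnn _)))//.
  have := @cnt_mod N N.+1 (mono P N) (leqnSn _); rewrite subSnn expn1 => <-.
  by apply: leq_cnt => j _ H; rewrite H andbT; exact: (mono_mod (leqnSn _) H).
apply: leq_cnt => j ltj /andP[Pj /bexP nP]; apply/andP; split.
  by apply/bexP; exists N.+1 => //; rewrite modn_small.
apply/bexP => -[u ltu]; rewrite modn_dvdm ?dvdn_exp2l// => Pu.
by apply: nP; exists u.
Qed.

(** The string [j] is [good] if it has extensions in [p] of every length. The branch takes bit 0
    whenever this stays good; otherwise [goodS] makes bit 1 good, since long extensions through bit
    0 are missing. *)
Lemma konig (p : nat -> nat -> bool) :
  (forall s j, j < 2 ^ s.+1 -> p s.+1 j -> p s (j %% 2 ^ s)) ->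
  (forall s, exists2 j, j < 2 ^ s & p s j) ->
  exists X : cantor_space, forall s, p s (pre X s).
Proof.
move=> pS pex.
have pmod s t k : s <= t -> k < 2 ^ t -> p t k -> p s (k %% 2 ^ s).
  move=> /subnKC <-; elim: (t - s) k => [|d IHd] k ltk pk.
    by rewrite addn0 in ltk pk; rewrite modn_small.
  rewrite addnS in ltk pk; have := IHd _ (ltn_pmod k (expn_gt0 2 _)) (pS _ _ ltk pk).
  by rewrite modn_dvdm// dvdn_exp2l ?leq_addr.
pose good s j := forall t, s <= t -> exists2 k, k < 2 ^ t & p t k && (k %% 2 ^ s == j).
have goodS s j : j < 2 ^ s -> good s j -> ~ good s.+1 j -> good s.+1 (j + 2 ^ s).
  move=> ltj gj /existsNP[t1 /not_implyP[st1 nt1]] t st.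
  have stm : s <= maxn t t1 by rewrite leq_max ltnW.
  have [k ltk /andP[pk /eqP kj]] := gj _ stm.
  have [k0|k1] : k %% 2 ^ s.+1 = j \/ k %% 2 ^ s.+1 = j + 2 ^ s.
    have : k %% 2 ^ s.+1 %% 2 ^ s = j by rewrite modn_dvdm ?dvdn_exp2l.
    have : k %% 2 ^ s.+1 < 2 * 2 ^ s by rewrite -expnS ltn_mod expn_gt0.
    set r := k %% _ => ltr rj; rewrite (divn_eq r (2 ^ s)) rj.
    have : r %/ 2 ^ s < 2 by rewrite ltn_divLR ?expn_gt0.
    by case: (r %/ _) => [|[|]]// _; [left|right]; lia.
  - case: nt1; exists (k %% 2 ^ t1); first by rewrite ltn_mod expn_gt0.
    by rewrite (pmod _ _ _ (leq_maxr t t1))//= modn_dvdm ?dvdn_exp2l// k0.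
  - exists (k %% 2 ^ t); first by rewrite ltn_mod expn_gt0.
    by rewrite (pmod _ _ _ (leq_maxl t t1))//= modn_dvdm ?dvdn_exp2l// k1.
pose J := fix J s := if s is s'.+1 then
  (if `[< good s (J s') >] then J s' else J s' + 2 ^ s') else 0.
pose X : cantor_space := fun s => ~~ `[< good s.+1 (J s) >].
have JX s : pre X s = J s.
  elim: s => [|s IHs]; first by rewrite /pre bsum0.
  by rewrite preS IHs [X s]/X /=; case: ifP => _; rewrite /= ?mul0n ?mul1n ?addn0.
have goodJ s : good s (J s).
  elim: s => [t _|s IHs] /=.
    by have [k ltk pk] := pex t; exists k; rewrite // pk expn0 modn1.
  case: asboolP => //; apply: goodS => //; rewrite -JX; exact: pre_lt.
exists X => s; have [k ltk /andP[pk /eqP kJ]] := goodJ s s (leqnn s).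
by rewrite JX -kJ modn_small.
Qed.

Lemma uniform_bound n (P : nat -> nat -> Prop) :
  (forall i, i < n -> exists M, forall M', M <= M' -> P i M') ->
  exists M, forall i, i < n -> forall M', M <= M' -> P i M'.
Proof.
elim: n => [|n IHn] H; first by exists 0.
have [M MP] := IHn (fun i lti => H i (ltnW lti)); have [M1 M1P] := H n (leqnn _).
exists (maxn M M1) => i; rewrite ltnS leq_eqVlt => /predU1P[->|lti] M';
  rewrite geq_max => /andP[MM' M1M'].
  exact: M1P.
exact: MP.
Qed.

(** Only finitely many strings have length [s], so one finite stage provides witnesses for all of
    them. *)
Lemma cnt_exists s (Q : nat -> nat -> Prop) :
  exists M, forall M', M <= M' ->
    cnt s (fun j => `[< exists i, Q i j >]) <= bsum M' (fun i => cnt s (fun j => `[< Q i j >])).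
Proof.
have [|M MP] := @uniform_bound (2 ^ s) (fun j M =>
    (exists i, Q i j) -> bex M (fun i => `[< Q i j >])).
  move=> j _; have [[i Qij]|nQ] := pselect (exists i, Q i j); last by exists 0.
  by exists i.+1 => M' ltiM' _; apply/bexP; exists i => //; exact/asboolP.
exists M => M' MM'; rewrite (leq_trans _ (cnt_bex _ _ _))//.
by apply: leq_cnt => j ltj /asboolP; exact: MP.
Qed.

(** * Covers by strings *)

Section Cover.
Variable R : realType.
Implicit Types (A B : set cantor_space) (r : R).
Local Open Scope ring_scope.

Definition wt (s : nat) (p : nat -> bool) : R := (cnt s p)%:R / 2 ^+ s.

Lemma exp2_gt0 s : 0 < 2 ^+ s :> R.
Proof. exact: exprn_gt0. Qed.

Lemma exp2_neq0 s : 2 ^+ s != 0 :> R.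
Proof. by rewrite gt_eqF ?exp2_gt0. Qed.

Lemma natr_exp2 s : (2 ^ s)%N%:R = 2 ^+ s :> R.
Proof. exact: natrX. Qed.

Lemma wt_ge0 s p : 0 <= wt s p.
Proof. by rewrite divr_ge0// ltW ?exp2_gt0. Qed.

Lemma wt_le s p r : (wt s p <= r) = ((cnt s p)%:R <= r * 2 ^+ s).
Proof. by rewrite ler_pdivrMr ?exp2_gt0. Qed.

Lemma wt_nat_le s p k : (cnt s p * 2 ^ k <= 2 ^ s)%N = (wt s p <= 2 ^- k).
Proof.
by rewrite wt_le mulrC ler_pdivlMr ?exp2_gt0// -!natr_exp2 -natrM ler_nat.
Qed.

Lemma wt_sub s (p q : nat -> bool) : (forall j, (j < 2 ^ s)%N -> p j -> q j) -> wt s p <= wt s q.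
Proof.
by move=> pq; rewrite ler_wpM2r ?ler_nat ?leq_cnt// invr_ge0 ltW ?exp2_gt0.
Qed.

Lemma wtU s (p q : nat -> bool) : wt s (fun j => p j || q j) <= wt s p + wt s q.
Proof.
by rewrite -mulrDl ler_wpM2r ?invr_ge0 ?(ltW (exp2_gt0 _))// -natrD ler_nat cntU.
Qed.

Lemma wt1 s p : wt s p <= 1.
Proof. by rewrite wt_le mul1r -natr_exp2 ler_nat cnt_max. Qed.

Lemma wtC s (p : nat -> bool) : wt s (fun j => ~~ p j) = 1 - wt s p.
Proof.
rewrite /wt cntC natrB ?cnt_max// natr_exp2 mulrBl divff//; exact: exp2_neq0.
Qed.

Lemma wtID s (p q : nat -> bool) :
  wt s p = wt s (fun j => p j && q j) + wt s (fun j => p j && ~~ q j).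
Proof. by rewrite -mulrDl -natrD -cntID. Qed.

Lemma wt_mod a s p : (a <= s)%N -> wt s (fun j => p (j %% 2 ^ a)%N) = wt a p.
Proof.
move=> les; rewrite /wt cnt_mod// natrM natr_exp2.
rewrite -{2}(subnKC les) exprD; field.
by rewrite ?exp2_neq0.
Qed.

Lemma wt_split a m (p q : nat -> bool) :
  wt (a + m) (fun j => p (j %% 2 ^ a)%N && q (j %/ 2 ^ a)%N) = wt a p * wt m q.
Proof. by rewrite /wt cnt_split natrM exprD invfM mulrACA. Qed.

(** A cover by strings, given by its sets [T s] of strings of length [s] *)
Definition cov A r := exists T : nat -> nat -> bool,
  (forall X, A X -> exists s, T s (pre X s)) /\
  forall N, \sum_(s < N) wt s (T s) <= r.

Lemma cov_sub A B r : A `<=` B -> cov B r -> cov A r.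
Proof. by move=> AB [T [TB Tr]]; exists T; split=> // X /AB /TB. Qed.

Lemma cov_le A r r' : r <= r' -> cov A r -> cov A r'.
Proof. by move=> rr' [T [TA Tr]]; exists T; split=> // N; exact: le_trans rr'. Qed.

Lemma covU A B r r' : cov A r -> cov B r' -> cov (A `|` B) (r + r').
Proof.
move=> [T [TA Tr]] [T' [TB Tr']]; exists (fun s j => T s j || T' s j); split.
  by move=> X [/TA|/TB] [s Ts]; exists s; rewrite Ts ?orbT.
move=> N; apply: le_trans (lerD (Tr N) (Tr' N)); rewrite -big_split /=.
by apply: ler_sum => s _; exact: wtU.
Qed.

Lemma cov_clopen s (p : nat -> bool) : cov [set X | p (pre X s)] (wt s p).
Proof.
exists (fun u j => (u == s) && p j); split=> [X pX|N].
  by exists s; rewrite eqxx.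
apply: (@le_trans _ _ (\sum_(u < N | (u : nat) == s) wt s p)).
  rewrite [leRHS]big_mkcond /=; apply: ler_sum => u _; case: eqP => [->|_].
    exact: wt_sub.
  by rewrite /wt /cnt /bsum big1// mul0r.
have [ltsN|leNs] := ltnP s N.
  by rewrite (big_pred1 (Ordinal ltsN)).
rewrite big1 ?wt_ge0// => u /eqP us.
by have := ltn_ord u; rewrite us ltnNge leNs.
Qed.

Lemma wt_exists s (Q : nat -> nat -> Prop) :
  exists M, forall M', (M <= M')%N ->
    wt s (fun j => `[< exists i, Q i j >]) <= \sum_(i < M') wt s (fun j => `[< Q i j >]).
Proof.
have [M MP] := cnt_exists s Q; exists M => M' /MP le.
rewrite /wt -mulr_suml ler_wpM2r ?invr_ge0 ?(ltW (exp2_gt0 _))//.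
by rewrite -natr_sum ler_nat.
Qed.

(** The covers are merged length by length; below length [N] finitely many of them suffice, by
    [wt_exists]. *)
Lemma cov_bigU (A : nat -> set cantor_space) (r : nat -> R) r' :
  (forall n, cov (A n) (r n)) -> (forall N, \sum_(n < N) r n <= r') ->
  cov (\bigcup_n A n) r'.
Proof.
move=> /choice[T TP] rr'.
exists (fun s j => `[< exists n, T n s j >]); split=> [X [n _ /(TP n).1 [s Ts]]|N].
  by exists s; apply/asboolP; exists n.
have [|M MP] := @uniform_bound N (fun s M => wt s (fun j => `[< exists i, T i s j >]) <=
    \sum_(i < M) wt s (fun j => `[< T i s j >])).
  by move=> s _; exact: wt_exists.
apply: (@le_trans _ _ (\sum_(s < N) \sum_(i < M) wt s (fun j => T i s j))).
  apply: ler_sum => s _; apply: le_trans (MP s (ltn_ord s) M (leqnn _)) _.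
  by apply: ler_sum => i _; apply: wt_sub => j _ /asboolP.
rewrite exchange_big; apply: le_trans (rr' M); apply: ler_sum => i _.
exact: (TP i).2.
Qed.

Lemma sum_exp2 k N : \sum_(n < N) 2 ^- (k + n).+1 = 2 ^- k - 2 ^- (k + N) :> R.
Proof.
elim: N => [|N IHN]; first by rewrite big_ord0 addn0 subrr.
rewrite big_ord_recr /= IHN addnS exprS; field.
by rewrite ?exp2_neq0.
Qed.

Lemma sum_exp2_le k N : \sum_(n < N) 2 ^- (k + n).+1 <= 2 ^- k :> R.
Proof. by rewrite sum_exp2 gerBl invr_ge0 ltW ?exp2_gt0. Qed.

(** Compactness: if at every level some string of [p] escaped the cover, [konig] would give a member
    of the closed class that the cover misses. *)
Lemma cov_closed (p : nat -> nat -> bool) r :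
  (forall s j, (j < 2 ^ s.+1)%N -> p s.+1 j -> p s (j %% 2 ^ s)%N) ->
  cov [set X | forall s, p s (pre X s)] r ->
  exists s, wt s (p s) <= r.
Proof.
move=> pS [T [TA Tr]].
pose p' s j := p s j && ~~ mono T s j.
have [s sP] : exists s, forall j, (j < 2 ^ s)%N -> ~~ p' s j.
  apply: contrapT => /forallNP nP.
  have [||X XP] := @konig p'.
  - move=> s j ltj /andP[/(pS _ _ ltj) pj nT]; rewrite /p' pj /=.
    by apply: contra nT; apply: mono_mod.
  - move=> s; have /existsNP[j /not_implyP[ltj /negP/negPn pj]] := nP s.
    by exists j.
  have /TA[s Ts] : forall s, p s (pre X s) by move=> s; have /andP[] := XP s.
  have /andP[_ /negP] := XP s; apply; apply/mono_pre; exists s => //.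
exists s; apply: le_trans (Tr s.+1).
apply: (@le_trans _ _ (wt s (mono T s))).
  apply: wt_sub => j /sP; rewrite negb_and negbK => /orP[/negbTE->//|//].
apply: (@le_trans _ _ (\sum_(u < s.+1) wt s (fun j => T u (j %% 2 ^ u)%N))).
  rewrite /wt -mulr_suml ler_wpM2r ?invr_ge0 ?(ltW (exp2_gt0 _))//.
  rewrite -natr_sum ler_nat.
  exact: (cnt_bex s s.+1 (fun u j => T u (j %% 2 ^ u)%N)).
by apply: ler_sum => u _; rewrite wt_mod// -ltnS.
Qed.

Lemma covT_ge1 r : cov setT r -> 1 <= r.
Proof.
move=> covT; have [||s] := @cov_closed (fun _ _ => true) r => //.
  by apply: cov_sub covT.
by rewrite /wt cntT natr_exp2 divff// exp2_neq0.
Qed.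

Lemma sum_first P N : \sum_(s < N) wt s (first P s) <= wt N (mono P N).
Proof.
apply: (@le_trans _ _ (\sum_(s < N.+1) wt s (first P s))).
  by rewrite big_ord_recr /= lerDl wt_ge0.
rewrite {2}/wt ler_pdivlMr ?exp2_gt0// mulr_suml.
apply: le_trans (_ : ((bsum N.+1 (fun s => cnt s (first P s) * 2 ^ (N - s)))%N%:R <= _)).
  rewrite natr_sum; apply: ler_sum => s _.
  have les : (s <= N)%N by rewrite -ltnS.
  have -> : 2 ^+ N = 2 ^+ s * 2 ^+ (N - s) :> R by rewrite -exprD subnKC.
  by rewrite natrM natr_exp2 /wt mulrA divfK// exp2_neq0.
by rewrite ler_nat cnt_first.
Qed.

(** The minimal strings of [P] generate the same open class, and Kraft's inequality bounds their
    weight. *)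
Lemma cov_open (P : nat -> nat -> bool) r : (forall N, wt N (mono P N) <= r) ->
  cov [set X | exists s, P s (pre X s)] r.
Proof.
move=> Pr; exists (first P); split=> [X /first_ex//|N].
exact: le_trans (sum_first P N) (Pr N).
Qed.

(** The Cauchy product of two series, cut off at total length [N]. *)
Lemma sum_conv (u v : nat -> R) N :
  \sum_(s < N) \sum_(a < s.+1) u a * v (s - a)%N =
  \sum_(a < N) u a * \sum_(b < N - a) v b.
Proof.
elim: N => [|N IHN]; first by rewrite !big_ord0.
rewrite big_ord_recr /= IHN.
have -> : \sum_(a < N.+1) u a * \sum_(b < N.+1 - a) v b =
  \sum_(a < N.+1) (u a * (\sum_(b < N - a) v b) + u a * v (N - a)%N).
  apply: eq_bigr => a _; have lea : (a <= N)%N by rewrite -ltnS.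
  by rewrite subSn// big_ord_recr /= mulrDr.
by rewrite big_split /= [in RHS]big_ord_recr /= subnn big_ord0 mulr0 addr0.
Qed.

(** Each string of [S] is followed by each string of a cover of [B]; weights multiply under
    concatenation. *)
Lemma cov_cat (S : nat -> nat -> bool) B q r :
  (forall N, \sum_(a < N) wt a (S a) <= q) -> cov B r ->
  cov [set X | exists2 a, S a (pre X a) & B (cut a X)] (q * r).
Proof.
move=> Sq [T [TB Tr]].
exists (fun s j => bex s.+1 (fun a => S a (j %% 2 ^ a)%N && T (s - a)%N (j %/ 2 ^ a)%N)).
split=> [X [a Sa /TB[b Tb]]|N].
  exists (a + b)%N; apply/bexP; exists a; first by rewrite ltnS leq_addr.
  by rewrite pre_mod ?leq_addr// pre_div addKn Sa.
apply: (@le_trans _ _ (\sum_(s < N) \sum_(a < s.+1) wt a (S a) * wt (s - a) (T (s - a)%N))).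
  apply: ler_sum => s _.
  apply: (@le_trans _ _ (\sum_(a < s.+1)
      wt s (fun j => S a (j %% 2 ^ a)%N && T (s - a)%N (j %/ 2 ^ a)%N))).
    rewrite /wt -mulr_suml ler_wpM2r ?invr_ge0 ?(ltW (exp2_gt0 _))//.
    rewrite -natr_sum ler_nat.
    exact: (cnt_bex s s.+1 (fun a j => S a (j %% 2 ^ a)%N && T (s - a)%N (j %/ 2 ^ a)%N)).
  apply: ler_sum => a _; have lea : (a <= s)%N by rewrite -ltnS.
  by have := wt_split a (s - a) (S a) (T (s - a)%N); rewrite subnKC// => ->.
rewrite (sum_conv (fun a => wt a (S a)) (fun b => wt b (T b))).
have r0 : 0 <= r by have := Tr 0%N; rewrite big_ord0.
apply: (@le_trans _ _ (\sum_(a < N) wt a (S a) * r)).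
  by apply: ler_sum => a _; rewrite ler_wpM2l ?wt_ge0.
by rewrite -mulr_suml ler_wpM2r.
Qed.

Lemma cov_shift A k r : cov A r ->
  cov [set Y | exists Z, A (glue k Z Y)] (2 ^+ k * r).
Proof.
move=> [T [TA Tr]].
(* Nothing remains of a string shorter than [k] after deleting [k] bits; it contributes the empty
   string, whose weight 1 is at most 2^k times that of the deleted string. *)
exists (fun s j => bex (2 ^ k) (fun i => T (k + s)%N (i + 2 ^ k * j)%N) ||
  (s == 0%N) && bex k (fun u => bex (2 ^ u) (T u))).
split=> [Y [Z /TA[s]]|N].
  have [leks|ltsk] := leqP k s.
    rewrite -{1 2}(subnKC leks) pre_glue_add => Ts; exists (s - k)%N.
    by apply/orP; left; apply/bexP; exists (pre Z k); rewrite ?pre_lt.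
  move=> Ts; exists 0%N; apply/orP; right; apply/bexP; exists s => //.
  by apply/bexP; exists (pre (glue k Z Y) s); rewrite ?pre_lt.
apply: (@le_trans _ _ (2 ^+ k * \sum_(s < k + N) wt s (T s))); last first.
  by rewrite ler_wpM2l// ltW ?exp2_gt0.
rewrite big_split_ord /= mulrDr addrC.
apply: (@le_trans _ _ (\sum_(s < N) (2 ^+ k * wt (k + s) (T (k + s)%N) +
    (if s == 0%N :> nat then \sum_(u < k) (cnt u (T u))%:R else 0)))).
  apply: ler_sum => s _; apply: le_trans (wtU _ _ _) _; apply: lerD.
    rewrite /wt exprD invfM !mulrA [2 ^+ k * _]mulrC mulfK ?exp2_neq0//.
    rewrite ler_wpM2r ?invr_ge0 ?(ltW (exp2_gt0 _))// ler_nat.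
    rewrite [X in (_ <= X)%N]/cnt expnD mulnC bsum_mul; apply: leq_bsum => j _.
    by rewrite bex_sum -/(bsum _ (fun i => nat_of_bool (T _ (i + _)%N))); case: (bsum _ _).
  have [->|_] := eqVneq (s : nat) 0%N; last by rewrite /wt /cnt /bsum big1// mul0r.
  rewrite /wt expr0 divr1 -natr_sum ler_nat /cnt expn0 bsumS bsum0 add0n /=.
  case: bexP => //= -[u ltuk /bexP[i lti Ti]].
  rewrite (bigD1 (Ordinal ltuk))//= (leq_trans _ (leq_addr _ _))//.
  rewrite /cnt /bsum (bigD1 (Ordinal lti))//= Ti//.
rewrite big_split /= -mulr_sumr lerD2l.
apply: (@le_trans _ _ (\sum_(u < k) (cnt u (T u))%:R)).
  case: N => [|N]; first by rewrite big_ord0 sumr_ge0.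
  by rewrite big_ord_recl [X in _ + X]big1 ?addr0// => i _; rewrite lift0.
rewrite mulr_sumr; apply: ler_sum => u _.
rewrite /wt mulrCA ler_peMr// ler_pdivlMr ?exp2_gt0// mul1r.
by rewrite ler_weXn2l ?ler1n// ltnW.
Qed.

Definition null A := forall k, cov A (2 ^- k).

Lemma null_sub A B : A `<=` B -> null B -> null A.
Proof. by move=> AB nB k; exact: cov_sub (nB k). Qed.

Lemma null_bigU (A : nat -> set cantor_space) :
  (forall n, null (A n)) -> null (\bigcup_n A n).
Proof.
move=> nA k; apply: (cov_bigU (r := fun n => 2 ^- (k + n).+1)) => [n|N].
  exact: nA.
exact: sum_exp2_le.
Qed.

Lemma null0 : null set0.
Proof.
move=> k; exists (fun _ _ => false); split=> // N.
by rewrite big1 ?invr_ge0 ?(ltW (exp2_gt0 _))// => s _; rewrite /wt /cnt /bsum big1// mul0r.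
Qed.

(** The fixed prefix, of weight at most 1, is put in front of a cover of the tails. *)
Lemma null_prefix A a Z :
  null [set Y | A (glue a Z Y)] -> null [set X | pre X a = pre Z a /\ A X].
Proof.
move=> nA k; rewrite -[2 ^- k]mul1r.
apply: cov_sub (cov_cat (S := fun b j => (b == a) && (j == pre Z a)) _ (nA k)).
  move=> X [XZ AX]; exists a; first by rewrite eqxx XZ /=.
  rewrite /= (_ : glue a Z _ = X)//; apply/funext => i.
  rewrite -[in RHS](glue_cut a X) /glue; case: ltnP => // ia.
  exact: esym (pre_eq XZ ia).
move=> N; apply: le_trans (_ : wt a (pred1 (pre Z a)) <= 1); last exact: wt1.
apply: (@le_trans _ _ (\sum_(b < N | (b : nat) == a) wt a (pred1 (pre Z a)))).
  rewrite [leRHS]big_mkcond /=; apply: ler_sum => u _; case: eqP => [->|_].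
    exact: wt_sub.
  by rewrite /wt /cnt /bsum big1// mul0r.
have [ltaN|leNa] := ltnP a N.
  by rewrite (big_pred1 (Ordinal ltaN)).
rewrite big1 ?wt_ge0// => u /eqP us.
by have := ltn_ord u; rewrite us ltnNge leNa.
Qed.

End Cover.

Lemma sigma01P A c n (X : cantor_space) :
  sigma01 A c n X <-> exists m, halts A c (pair_nat n (2 ^ m + pre X m).-1).
Proof.
split=> [[s hs /cylinderP Xs]|[m hm]].
  by exists (size s); rewrite Xs -string_numE.
exists (mkseq X m); first by rewrite /= string_num_mkseq.
by move=> i; rewrite size_mkseq => lti; rewrite nth_mkseq.
Qed.

(** Strings numbered as by [string_num]: the number [i] stands for the string of
    length [slen i] with code [sval i]. *)
Definition slen (i : nat) : nat := trunc_log 2 i.+1.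
Definition scode (i : nat) : nat := i.+1 - 2 ^ slen i.

Lemma slen_pre s j : j < 2 ^ s -> slen (2 ^ s + j).-1 = s.
Proof.
move=> ltj; rewrite /slen prednK ?addn_gt0 ?expn_gt0//.
by apply: trunc_log_eq => //; rewrite leq_addr /= expnS mul2n -addnn ltn_add2l.
Qed.

Lemma scode_pre s j : j < 2 ^ s -> scode (2 ^ s + j).-1 = j.
Proof.
move=> ltj; rewrite /scode slen_pre// prednK ?addn_gt0 ?expn_gt0//.
by rewrite addKn.
Qed.

(** * The fair-coin outer measure in terms of covers *)

Section FairCoin.
Variable R : realType.
Local Open Scope ring_scope.

Lemma exp_small (q e : R) : 0 <= q -> q < 1 -> 0 < e -> exists m, q ^+ m < e.
Proof.
move=> q0 q1 e0; have q1' : `|q| < 1 by rewrite ger0_norm.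
have /cvgrPdist_lt /(_ e e0) [N _ /(_ N (leqnn N))] := cvg_expr q1'.
by rewrite /= sub0r normrN ger0_norm ?exprn_ge0//; exists N.
Qed.

Lemma fair_coin_ge0 (A : set cantor_space) : (0 <= fair_coin R A)%E.
Proof.
apply: le_ereal_inf_tmp => _ [s _ <-]; apply: nneseries_ge0 => n _ _.
by rewrite lee_fin invr_ge0 ltW ?exp2_gt0.
Qed.

(** The strings of the sequence are sorted by length, repetitions being merged. *)
Lemma fair_coin_lt (A : set cantor_space) (r : R) : (fair_coin R A < r%:E)%E -> cov A r.
Proof.
move=> /ereal_inf_lt[_ [t tA <-] tr].
have tN N : \sum_(i < N) 2 ^- size (t i) <= r.
  rewrite -lee_fin; apply: le_trans (ltW tr).
  rewrite -sumEFin -(big_mkord xpredT (fun i => (2 ^- size (t i))%:E)).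
  by apply: nneseries_lim_ge => n _ _; rewrite lee_fin invr_ge0 ltW ?exp2_gt0.
pose Q i s j := size (t i) = s /\ pre (nth false (t i)) s = j.
exists (fun s j => `[< exists i, Q i s j >]); split=> [X /tA[i _ /cylinderP Xi]|N].
  by exists (size (t i)); apply/asboolP; exists i; split.
have [|M MP] := @uniform_bound N (fun s M => wt R s (fun j => `[< exists i, Q i s j >]) <=
    \sum_(i < M) wt R s (fun j => `[< Q i s j >])).
  by move=> s _; exact: (wt_exists R s (fun i j => Q i s j)).
apply: le_trans (tN M).
apply: (@le_trans _ _ (\sum_(s < N) \sum_(i < M) if size (t i) == s then 2 ^- size (t i) else 0)).
  apply: ler_sum => s _; apply: le_trans (MP s (ltn_ord s) M (leqnn _)) _.
  apply: ler_sum => i _; case: eqP => [ts|ts]; last first.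
    rewrite /wt /cnt /bsum big1 ?mul0r// => j _.
    by case: asboolP => // -[/ts].
  rewrite wt_le ts mulVf ?exp2_neq0// -[1]/(1%:R) ler_nat.
  apply: (@leq_trans (\sum_(j < 2 ^ s | (j : nat) == pre (nth false (t i)) s) 1)).
    rewrite [leqRHS]big_mkcond /=; apply: leq_sum => j _.
    by case: asboolP => [[_ ->]|]; rewrite ?eqxx.
  by rewrite (big_pred1 (Ordinal (pre_lt (nth false (t i)) s))).
rewrite exchange_big; apply: ler_sum => i _ /=.
rewrite -big_mkcond /=.
have [lti|leN] := ltnP (size (t i)) N.
  by rewrite (big_pred1 (Ordinal lti))// => j; rewrite eq_sym.
rewrite big1 ?invr_ge0 ?(ltW (exp2_gt0 _ _))// => s /eqP ts.
by have := ltn_ord s; rewrite -ts ltnNge leN.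
Qed.

Lemma cov_fair_coin (A : set cantor_space) (r : R) : cov A r -> (fair_coin R A <= r%:E)%E.
Proof.
move=> [T [TA Tr]]; apply/lee_addgt0Pr => e e0.
have [m /ltW me] : exists m, 2 ^- m < e.
  by have [m] := @exp_small 2^-1 e ltac:(lra) ltac:(lra) e0; rewrite exprVn; exists m.
(* All strings are listed in the order of [string_num]. A slot whose string is not in [T] gets a
   filler of length [(m + i).+1]; the fillers weigh at most 2^-m in total. *)
pose t i := if T (slen i) (scode i) then mkseq (testbit (scode i)) (slen i)
  else nseq (m + i).+1 false.
apply: (@le_trans _ _ (\sum_(0 <= i <oo) (2 ^- size (t i))%:E)%E).
  apply: ereal_inf_lbound; exists t => //= X /TA[s Ts].
  exists (2 ^ s + pre X s).-1%N => //; rewrite /t slen_pre ?scode_pre ?pre_lt// Ts.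
  move=> i; rewrite size_mkseq => lti; rewrite nth_mkseq//.
  by rewrite testbit_pre.
have t0 n : (0 <= (2 ^- size (t n))%:E :> \bar R)%E.
  by rewrite lee_fin invr_ge0 ltW ?exp2_gt0.
apply: lime_le; first by apply: is_cvg_nneseries => n _ _.
(* The strings of length below [N] occupy exactly the first [(2 ^ N).-1] slots, and [N] is at most
   that. *)
apply: nearW => N; apply: (@le_trans _ _ (\sum_(0 <= i < (2 ^ N).-1) (2 ^- size (t i))%:E)%E).
  apply: (@lee_sum_nneg_natr _ _ xpredT) => //.
  by rewrite -ltnS prednK ?expn_gt0// ltn_expl.
rewrite big_mkord sumEFin lee_fin; apply: le_trans (_ : r + 2 ^- m <= _); last first.
  by rewrite lerD2l.
apply: le_trans (lerD (Tr N) (sum_exp2_le R m (2 ^ N).-1)).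
apply: (@le_trans _ _ (\sum_(i < (2 ^ N).-1) ((if T (slen i) (scode i) then 2 ^- slen i else 0) +
  2 ^- (m + i).+1))).
  apply: ler_sum => i _; rewrite /t; case: ifP => _.
    by rewrite size_mkseq lerDl invr_ge0 ltW ?exp2_gt0.
  by rewrite size_nseq add0r.
rewrite big_split /= lerD2r.
elim: N => [|N IHN]; first by rewrite !big_ord0.
have -> : (2 ^ N.+1).-1 = ((2 ^ N).-1 + 2 ^ N)%N.
  by rewrite expnS; have := expn_gt0 2 N; lia.
rewrite big_split_ord /= [in leRHS]big_ord_recr /=; apply: lerD => //.
rewrite /wt /cnt /bsum natr_sum mulr_suml; apply: ler_sum => j _.
have -> : ((2 ^ N).-1 + j = (2 ^ N + j).-1)%N by have := expn_gt0 2 N; lia.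
rewrite slen_pre// scode_pre//; by case: (T _ _); rewrite ?mul1r ?mul0r.
Qed.

Lemma fair_coin_null (A : set cantor_space) : fair_coin R A = 0%E <-> null R A.
Proof.
split=> [A0 k|nA].
  by apply: fair_coin_lt; rewrite A0 lte_fin invr_gt0 exp2_gt0.
apply/eqP; rewrite eq_le fair_coin_ge0 andbT; apply/lee_addgt0Pr => e e0.
have [m] := @exp_small 2^-1 e ltac:(lra) ltac:(lra) e0; rewrite exprVn => me.
by apply: le_trans (cov_fair_coin (nA m)) _; rewrite add0e lee_fin ltW.
Qed.

Lemma fair_coin_gt0 (A : set cantor_space) : (0 < fair_coin R A)%E <-> ~ null R A.
Proof.
rewrite -fair_coin_null lt_neqAle fair_coin_ge0 andbT eq_sym.
by split=> [/eqP//|/eqP].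
Qed.

(** The infimum need not be attained, hence the strict inequality; its uses take one extra index of
    the test. *)
Lemma ml_test_cov A c n (r : R) :
  ml_test R A c -> 2 ^- n < r -> cov (sigma01 A c n) r.
Proof.
by move=> At nr; apply: fair_coin_lt; apply: le_lt_trans (At n) _; rewrite lte_fin.
Qed.

End FairCoin.

Lemma comp_slen S F : comp S F -> comp S (fun X z => slen (F X z)).
Proof.
move=> cF; apply: (@comp_comp _ (fun _ => slen)) => //.
apply: (@comp_mu _ (fun _ z y => ~~ (2 ^ y.+1 <= z.+1))); first by comp_tac.
  by move=> X _ z; rewrite -ltnNge trunc_log_ltn.
move=> X _ z y lty; rewrite negbK.
apply: (leq_trans _ (@trunc_logP 2 z.+1 isT isT)).
by rewrite leq_exp2l.
Qed.

Lemma comp_scode S F : comp S F -> comp S (fun X z => scode (F X z)).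
Proof.
by move=> cF; rewrite /scode; have H := comp_slen cF; comp_tac.
Qed.

Ltac comp_hook ::=
  lazymatch goal with
  | |- comp _ (fun X z => slen (@?a X z)) => refine (@comp_slen _ a _)
  | |- comp _ (fun X z => scode (@?a X z)) => refine (@comp_scode _ a _)
  | |- comp _ (fun X z => cnt (@?s X z) (@?p X z)) => refine (@comp_cnt _ s p _ _)
  | |- comp _ (fun X z => pre (@?q X z) (@?s X z)) => refine (@comp_pre _ s q _ _)
  | |- comp _ (fun X z => nat_of_bool (cert (@?q X z) (@?e X z) (@?x X z) (@?W X z))) =>
      refine (@comp_cert _ q e x W _ _ _ _)
  | |- comp _ (fun X z => nat_of_bool (first _ _ _)) => rewrite /first
  | |- comp _ (fun X z => nat_of_bool (mono _ _ _)) => rewrite /mono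
  end.

Lemma comp4 S (g : cantor_space -> nat -> nat -> nat -> nat -> nat) F G H K :
  comp S (fun X w => g X (p1 w) (p1 (p2 w)) (p1 (p2 (p2 w))) (p2 (p2 (p2 w)))) ->
  comp S F -> comp S G -> comp S H -> comp S K ->
  comp S (fun X z => g X (F X z) (G X z) (H X z) (K X z)).
Proof.
move=> cg cF cG cH cK.
apply: comp_ext (comp_comp cg (comp_pair cF (comp_pair cG (comp_pair cH cK)))) => X SX z.
by rewrite !(p1_pair, p2_pair).
Qed.

(** The program decodes the string number into length and code, then searches for [w]. *)
Lemma sigma01_program A (r : nat -> nat -> nat -> nat -> bool) :
  comp [set A] (fun _ w =>
    nat_of_bool (r (p1 w) (p1 (p2 w)) (p1 (p2 (p2 w))) (p2 (p2 (p2 w))))) ->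
  exists c, forall n X, sigma01 A c n X <-> exists m w, r n m (pre X m) w.
Proof.
move=> cr.
have [|c cP] := @mu_program [set A]
  (fun _ z w => r (p1 z) (slen (p2 z)) (scode (p2 z)) w).
  by apply: (comp4 (g := fun _ a b c d => nat_of_bool (r a b c d))) => //; comp_tac.
exists c => n X; rewrite sigma01P.
have rE m w : r (p1 (pair_nat n (2 ^ m + pre X m).-1))
    (slen (p2 (pair_nat n (2 ^ m + pre X m).-1)))
    (scode (p2 (pair_nat n (2 ^ m + pre X m).-1))) w = r n m (pre X m) w.
  by rewrite p1_pair p2_pair slen_pre ?scode_pre ?pre_lt.
split=> [[m [w /(cP A erefl)[rw _]]]|[m exw]]; first by exists m, w; rewrite -rE.
exists m; case: (ex_minnP exw) => w rw wmin; exists w; apply/(cP A erefl).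
split; first by rewrite rE.
by move=> w'; apply: contraTN; rewrite rE -leqNgt => /wmin.
Qed.

(** * Randomness and Pi^0_1 classes *)

Definition pi01 (A : cantor_space) (F : set cantor_space) :=
  exists2 W : nat -> nat -> bool, comp [set A] (fun _ z => nat_of_bool (W (p1 z) (p2 z))) &
    F = [set Y | forall s, ~~ W s (pre Y s)].

Section Blocks.
Variable R : realType.
Local Open Scope ring_scope.

Lemma not_null (F : set cantor_space) : ~ null R F -> exists k, ~ cov F (2 ^- k : R).
Proof. by move=> /existsNP. Qed.

(** The strings of length [N] that are not excluded cover the class, so they weigh more than [r]. *)
Lemma wt_mono_not_cov W (r : R) N :
  ~ cov [set Y | forall s, ~~ W s (pre Y s)] r -> wt R N (mono W N) <= 1 - r.
Proof.
move=> nF; rewrite leNgt; apply/negP => lt; apply: nF.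
apply: cov_sub (cov_le _ (cov_clopen R N (fun j => ~~ mono W N j))).
  by move=> X XF /=; apply/negP => /mono_pre[u _]; rewrite (negbTE (XF u)).
by rewrite wtC; lra.
Qed.

(** The reals of the form tau_0 ... tau_{N-1} Y with [tau_i] a minimal string
    in [W]; [b i] is the position at which [tau_i] starts. *)
Definition parses (W : nat -> nat -> bool) (b : nat -> nat) (N : nat) (X : cantor_space) :=
  b 0%N = 0%N /\ forall i, (i < N)%N ->
    (b i <= b i.+1)%N && first W (b i.+1 - b i) (pre (cut (b i) X) (b i.+1 - b i)).

(** The blocks are independent, and each contributes a factor [q]. *)
Lemma cov_parses W (q : R) N : (forall N, wt R N (mono W N) <= q) ->
  cov [set X | exists b, parses W b N X] (q ^+ N).
Proof.
move=> Wq; elim: N => [|N IHN].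
  apply: cov_sub (_ : cov [set X | xpredT (pre X 0)] _) => //.
  by apply: cov_le (cov_clopen R 0 xpredT); exact: wt1.
rewrite exprS; apply: cov_sub (cov_cat (S := first W) _ IHN); last first.
  by move=> M; exact: le_trans (sum_first R W M) (Wq M).
move=> X [b [b0 bP]]; exists (b 1%N).
  have /andP[_] := bP 0%N isT; rewrite b0 subn0 (_ : cut 0 X = X)//.
have b1 i : (i <= N)%N -> (b 1 <= b i.+1)%N.
  elim: i => // i IHi lti; apply: leq_trans (IHi (ltnW lti)) _.
  by have /andP[] := bP i.+1 lti.
exists (fun i => b i.+1 - b 1)%N; split=> [|i lti]; first by rewrite subnn.
have /andP[bi fi] := bP i.+1 lti; have := b1 i (ltnW lti) => b1i.
by rewrite leq_sub2r//= subnBA// subnK ?(leq_trans b1i)// cut_cut subnKC.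
Qed.

(** A positive-measure complement gives a bound [q < 1] for the open class of [W]. With
    [q ^+ m < 1/2], the reals starting with [n * m] blocks form member [n] of a test. *)
Lemma parses_not_random A W b X :
  comp [set A] (fun _ z => nat_of_bool (W (p1 z) (p2 z))) ->
  ~ null R [set Y | forall s, ~~ W s (pre Y s)] ->
  (forall N, parses W b N X) -> ~ ml_random R A X.
Proof.
move=> cW /not_null[k /wt_mono_not_cov nF] bP.
set q : R := 1 - 2 ^- k in nF.
have q0 : 0 <= q by apply: le_trans (nF 0%N); exact: wt_ge0.
have q1 : q < 1 by rewrite /q gtrBl invr_gt0 exp2_gt0.
have [m qm] := @exp_small R q 2^-1 q0 q1 ltac:(lra).
(* [w] lists the block boundaries, all within the prefix of length [L] coded by [j]. *)
pose r n L j w := (nthc w 0 == 0)%N && ball (n * m) (fun i =>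
  (nthc w i <= nthc w i.+1)%N && (nthc w i.+1 <= L)%N &&
  first W (nthc w i.+1 - nthc w i)
    ((j %/ 2 ^ nthc w i) %% 2 ^ (nthc w i.+1 - nthc w i))).
have [|c cP] := @sigma01_program A r; first by rewrite /r; comp_tac.
have seg Y L a a' : (a <= a')%N -> (a' <= L)%N ->
    ((pre Y L %/ 2 ^ a) %% 2 ^ (a' - a) = pre (cut a Y) (a' - a))%N.
  move=> aa' a'L; rewrite -(subnKC (leq_trans aa' a'L)) pre_div pre_mod//.
  by rewrite leq_sub2r.
move=> /(_ c); apply.
  move=> n; apply: le_trans (_ : (q ^+ (n * m))%:E <= _)%E.
    apply: cov_fair_coin; apply: cov_sub (cov_parses (n * m) nF).
    move=> Y /cP[L [w /andP[/eqP w0 /ballP wP]]]; exists (nthc w); split=> // i lti.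
    have /andP[/andP[le1 le2]] := wP i lti.
    by rewrite seg// => ->; rewrite le1.
  rewrite lee_fin mulnC exprM -exprVn; apply: lerXn2r; rewrite ?nnegrE ?exprn_ge0 ?(ltW qm)//.
move=> n _; apply/cP; exists (b (n * m))%N.
have [w wP] := nthc_ex (mkseq b (n * m).+1).
have wb i : (i <= n * m)%N -> nthc w i = b i.
  by move=> lei; rewrite wP ?size_mkseq// nth_mkseq.
have bmono i j : (i <= j)%N -> (b i <= b j)%N.
  elim: j => [|j IHj]; first by rewrite leqn0 => /eqP->.
  rewrite leq_eqVlt => /predU1P[->//|/IHj/leq_trans]; apply.
  by have [_ /(_ j (leqnn _))/andP[]] := bP j.+1.
exists w; rewrite /r wb//; have [-> bN] := bP (n * m)%N; rewrite eqxx /=.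
apply/ballP => i lti; rewrite !wb ?(ltnW lti)//.
have /andP[le1 fi] := bN i lti.
by rewrite le1 bmono//= seg ?bmono.
Qed.

(** If no tail lies in [F], a minimal string of [W] can be split off again and again. *)
Lemma random_tail A F X :
  pi01 A F -> ~ null R F -> ml_random R A X -> exists a, F (cut a X).
Proof.
move=> [W cW ->] nF rX; apply: contrapT => /forallNP noF.
have /choice[l lP] : forall a, exists s, first W s (pre (cut a X) s).
  by move=> a; apply: first_ex; have /existsNP[s /negP/negPn Ws] := noF a; exists s.
pose b := fix b i := if i is i'.+1 then (b i' + l (b i'))%N else 0%N.
apply: (@parses_not_random A W b X cW nF) rX => N; split=> // i _ /=.
by rewrite leq_addr /= addKn; exact: lP.
Qed.

End Blocks.

(** * Positive-measure dominating oracles *)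

Definition happrox (t e : nat) : bool := bex t (fun W => cert (fun=> false) e e W).

Lemma happrox_lim n : exists t0, forall t, t0 <= t -> forall e, e < n ->
  happrox t e = halting_problem e.
Proof.
have [|t0 t0P] := @uniform_bound n (fun e t => happrox t e = halting_problem e).
  move=> e _; case He : (halting_problem e).
    have [W We] := (halting_problemP e).1 He.
    by exists W.+1 => t ltW; apply/bexP; exists W.
  exists 0 => t _; apply/negP => /bexP[W _ We].
  by move: He; rewrite (halting_problemP e).2//; exists W.
by exists t0 => t t0t e lte; exact: t0P.
Qed.

(** [refutes c u z t] decodes [z] as [(k, (j, (m, (W, t0))))] and says that at
    some stage [t >= t0] of the enumeration of the halting problem [W] is not a
    certificate that the test [c] captures, in its member of index [2 k + 3],
    the first [m] bits of [j] followed by [u]. *)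
Definition refutes (c : program) (u z t : nat) : bool :=
  (p2 (p2 (p2 (p2 z))) <= t) && ~~ cert (happrox t) (goedel c)
    (pair_nat (2 * p1 z + 3) (2 ^ p1 (p2 (p2 z)) +
      (p1 (p2 z) %% 2 ^ p1 z + 2 ^ p1 z * u) %% 2 ^ p1 (p2 (p2 z))).-1)
    (p1 (p2 (p2 (p2 z)))).

Definition plen (z : nat) : nat := p1 (p2 (p2 z)).

Lemma plen_le z : plen z <= z.
Proof. by rewrite /plen (leq_trans (p1_le _))// (leq_trans (p2_le _))// p2_le. Qed.

Lemma comp_refutes S c F G H :
  comp S F -> comp S G -> comp S H ->
  comp S (fun X z => nat_of_bool (refutes c (F X z) (G X z) (H X z))).
Proof. by move=> cF cG cH; rewrite /refutes /happrox; comp_tac. Qed.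

Definition captured (c : program) (k : nat) : set cantor_space :=
  [set Y | exists Z, sigma01 halting_problem c (2 * k + 3) (glue k Z Y)].

(** A captured [Y] has a true certificate; choosing [t0] after 0' has settled below it makes
    refutation impossible. If [Y] is not captured, any stage past [t0] and the settling time refutes
    [W]. *)
Lemma refutesP c Y :
  (forall z, exists t, refutes c (pre Y (plen z)) z t) <->
  ~ (\bigcup_k captured c k) Y.
Proof.
split=> [H [k _ [Z /sigma01P[m /haltsP[W]]]]|nY z].
  rewrite -(pre_mod (glue k Z Y) (leq_addl k m)) pre_glue_add => cW.
  have [t0 t0P] := happrox_lim W.
  pose z := pair_nat k (pair_nat (pre Z k) (pair_nat m (pair_nat W t0))).
  have [t] := H z; rewrite /refutes /plen /z !(p1_pair, p2_pair) => /andP[t0t].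
  by rewrite (eq_cert _ _ (t0P t t0t)) (modn_small (pre_lt _ _)) cW.
have [t1 t1P] := happrox_lim (p1 (p2 (p2 (p2 z)))).
exists (maxn (p2 (p2 (p2 (p2 z)))) t1); rewrite /refutes leq_maxl /=.
rewrite (eq_cert _ _ (t1P _ (leq_maxr _ _))); apply/negP => cW; apply: nY.
exists (p1 z) => //; exists (testbit (p1 (p2 z))); apply/sigma01P.
exists (plen z); apply/haltsP; exists (p1 (p2 (p2 (p2 z)))).
by rewrite -(pre_mod _ (leq_addl (p1 z) _)) pre_glue_add pre_testbit.
Qed.

Section Domination.
Variable R : realType.
Local Open Scope ring_scope.

(** Deleting [k] bits costs a factor 2^k, so index [2 * k + 3] leaves weight 2^-(k+2), and these sum
    to 1/2. *)
Lemma cov_captured c : ml_test R halting_problem c ->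
  cov (\bigcup_k captured c k) (2^-1 : R).
Proof.
move=> ct; apply: (cov_bigU (r := fun k => 2 ^- (1 + k).+1)) => [k|N]; last first.
  exact: sum_exp2_le.
have -> : 2 ^- (1 + k).+1 = 2 ^+ k * 2 ^- (2 * k + 2) :> R.
  rewrite mul2n -addnn -addnA [in RHS]exprD addn2 add1n; field.
  by rewrite ?exp2_neq0.
apply: cov_shift; apply: ml_test_cov ct _.
rewrite ltf_pV2 ?posrE ?exp2_gt0//.
by rewrite ltr_eXn2l ?ltr1n// ltn_add2l.
Qed.

Lemma dominating_low (B : cantor_space) :
  positive_measure_dominating R B -> low_for_random R halting_problem B.
Proof.
move=> dom X rX c ct Xc.
have [|d dP] := @mu_program setT (fun Y z t => refutes c (pre Y (plen z)) z t).
  by apply: comp_refutes; rewrite /plen; comp_tac.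
have TotE : Tot d = ~` \bigcup_k captured c k.
  apply/seteqP; split=> Y.
    move=> Yt; apply/refutesP => z.
    by have [t /(dP Y I)[tP _]] := Yt z; exists t.
  move=> /refutesP Yt z; case: (ex_minnP (Yt z)) => t tP tmin.
  exists t; apply/(dP Y I); split=> // t'; apply: contraTN; rewrite -leqNgt.
  exact: tmin.
have [[f [[e eP] /fair_coin_gt0 fpos]]|/fair_coin_null Tot0] := dom d; last first.
  (* A null [Tot d] would give the whole space a cover of weight 1/2 + 1/4. *)
  have := covU (cov_captured ct) (Tot0 2%N).
  rewrite TotE setUv => /covT_ge1; lra.
have cf : comp [set B] (fun _ => f) by exists e => _ ->.
(* The prefix of length [z] suffices because [plen z <= z]; this puts the class in the form required
   by [pi01]. *)
pose F M := [set Y : cantor_space | forall z, ~~ ~~ bex (f z + M).+1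
  (refutes c (pre Y z %% 2 ^ plen z) z)].
have [M FM] : exists M, ~ null R (F M).
  apply: contrapT => /forallNP nF; apply: fpos.
  apply: null_sub (null_bigU (fun M => contrapT (nF M))).
  (* The sum of the values of [g] below [N] is the constant that turns domination from [N] on into a
     bound everywhere. *)
  move=> Y [g [gP [N fg]]]; exists (bsum N g) => // z; rewrite negbK.
  apply/bexP; exists (g z).
    rewrite ltnS; have [Nz|zN] := leqP N z; first by rewrite (leq_trans (fg z Nz))// leq_addr.
    rewrite (leq_trans _ (leq_addl _ _))// /bsum (bigD1 (Ordinal zN))//=; exact: leq_addr.
  by rewrite pre_mod ?plen_le//; have [] := (dP Y I z (g z)).1 (gP z).
have F01 : pi01 B (F M).
  exists (fun z u => ~~ bex (f z + M).+1 (refutes c (u %% 2 ^ plen z) z)); last by [].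
  apply: comp_neg.
  apply: (@comp_bex _ (fun _ z => (f (p1 z) + M).+1)
    (fun _ z => refutes c (p2 z %% 2 ^ plen (p1 z)) (p1 z))); first by comp_tac.
  by apply: comp_refutes; rewrite /plen; comp_tac.
have [a Fa] := random_tail F01 FM rX.
have /refutesP : forall z, exists t, refutes c (pre (cut a X) (plen z)) z t.
  move=> z; have /negPn/bexP[t _] := Fa z; rewrite pre_mod ?plen_le//; first by exists t.
(* The tail is captured with [k = a]: gluing back the deleted bits returns [X]. *)
by apply; exists a => //; exists X; rewrite glue_cut; exact: Xc.
Qed.

End Domination.

(** * Oracles relative to which 0' is low for random *)

Fixpoint const_program (x : nat) : program :=
  if x is x'.+1 then PComp PSucc (const_program x') else PZero.

Lemma eval_const X x z : eval X (const_program x) z x.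
Proof. by elim: x => //= x IHx; exists x. Qed.

(** The number [h x] belongs to a program that ignores its input and searches for [t] with [r x t];
    0' is asked about [h x]. *)
Lemma halting_decides (r : nat -> nat -> bool) :
  comp setT (fun _ z => nat_of_bool (r (p1 z) (p2 z))) ->
  comp [set halting_problem] (fun _ x => nat_of_bool `[< exists t, r x t >]).
Proof.
move=> /(@mu_program _ (fun=> r))[d dP].
pose h x := goedel (PComp d (const_program x)).
have ch : comp [set halting_problem] (fun _ => h).
  have c1 : comp [set halting_problem] (fun _ x =>
      pair_nat 6 (pair_nat (goedel d)
        (iter x (pair_nat 6 \o pair_nat (goedel PSucc)) (goedel PZero)))).
    apply: comp_pair; first exact: comp_const.
    apply: comp_pair; first exact: comp_const.
    apply: (@comp_iter _ (fun _ x => x) (fun _ _ => goedel PZero)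
      (fun _ _ => pair_nat 6 \o pair_nat (goedel PSucc))).
    - exact: comp_id.
    - exact: comp_const.
    - by apply: comp_pair; [exact: comp_const|apply: comp_pair; [exact: comp_const|exact: comp_p2]].
  apply: comp_ext c1 => X _ x; congr (pair_nat 6 (pair_nat _ _)).
  by elim: x => //= x ->.
apply: comp_ext (comp_oracle ch) => _ -> x; congr nat_of_bool.
apply/idP/idP => [/asboolP[e [/goedel_inj-> [y [z xz zy]]]]|/asboolP ext].
  rewrite -(eval_fun (eval_const _ x _) xz) in zy.
  by apply/asboolP; exists y; have [] := (dP _ I x y).1 zy.
apply/asboolP; exists (PComp d (const_program x)); split=> //.
case: (ex_minnP ext) => t xt tmin; exists t, x; first exact: eval_const.
by apply/(dP _ I); split=> // y; apply: contraTN; rewrite -leqNgt; exact: tmin.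
Qed.

(** A certificate below [s] queries only bits below [s], so a string of length [s] is oracle
    enough. *)
Definition conv (c : program) (n s j : nat) : bool :=
  bex s (fun V => cert (testbit j) (goedel c) n V).

Lemma conv_pre c n s X :
  conv c n s (pre X s) <-> exists2 V, V < s & cert X (goedel c) n V.
Proof.
have H V : V < s -> cert (testbit (pre X s)) (goedel c) n V = cert X (goedel c) n V.
  by move=> ltV; apply: eq_cert => i ltiV; rewrite testbit_pre// (ltn_trans ltiV).
split=> [/bexP[V ltV]|[V ltV cV]]; first by rewrite H//; exists V.
by apply/bexP; exists V; rewrite ?H.
Qed.

Lemma conv_mod c n s t j : s <= t -> conv c n s (j %% 2 ^ s) -> conv c n t j.
Proof.
move=> st /bexP[V ltV]; rewrite -pre_testbit => cV.
apply/bexP; exists V; first exact: leq_trans st.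
rewrite -(@eq_cert (testbit (pre (testbit j) s)))// => i ltiV.
by rewrite testbit_pre// (ltn_trans ltiV).
Qed.

Lemma TotP c X : Tot c X <-> forall n, exists s, conv c n s (pre X s).
Proof.
split=> H n; first by have /haltsP[V cV] := H n; exists V.+1; apply/conv_pre; exists V.
by have [s /conv_pre[V _ cV]] := H n; apply/haltsP; exists V.
Qed.

Lemma pi01I A F G : pi01 A F -> pi01 A G -> pi01 A (F `&` G).
Proof.
move=> [W cW ->] [V cV ->]; exists (fun s j => W s j || V s j); first by comp_tac.
apply/seteqP; split=> Y /=; first by move=> [WY VY] s; rewrite negb_or WY VY.
by move=> H; split=> s; have := H s; rewrite negb_or => /andP[].
Qed.

Lemma pi01_glue A F a Z : pi01 A F -> pi01 A [set Y | F (glue a Z Y)].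
Proof.
move=> [W cW ->].
exists (fun s j => bex s.+1 (fun m => W m ((pre Z a + 2 ^ a * j) %% 2 ^ m))).
  by comp_tac.
have H m s Y : m <= s -> (pre Z a + 2 ^ a * pre Y s) %% 2 ^ m = pre (glue a Z Y) m.
  by move=> lem; rewrite -pre_glue_add pre_mod// (leq_trans lem)// leq_addl.
apply/seteqP; split=> Y /= YP s.
  by apply/negP => /bexP[m]; rewrite ltnS => lem; rewrite H// (negbTE (YP m)).
by apply: contra (YP s) => Ws; apply/bexP; exists s; rewrite ?H.
Qed.

(** Length bounds the search for certificates; a capture that is found late excludes a longer string
    instead. *)
Lemma pi01_sigma01 A c k : pi01 A (~` sigma01 A c k).
Proof.
exists (fun s j => bex s.+1 (fun m => bex s.+1 (fun V =>
    cert A (goedel c) (pair_nat k (2 ^ m + j %% 2 ^ m).-1) V))).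
  apply: comp_ext (_ : comp _ (fun X z => nat_of_bool
      (bex (p1 z).+1 (fun m => bex (p1 z).+1 (fun V =>
        cert X (goedel c) (pair_nat k (2 ^ m + p2 z %% 2 ^ m).-1) V))))).
    by move=> _ ->.
  by comp_tac.
apply/seteqP; split=> Y /= YP.
  move=> s; apply/negP => /bexP[m]; rewrite ltnS => lem /bexP[V _ cV]; apply: YP.
  by apply/sigma01P; exists m; apply/haltsP; exists V; rewrite -(pre_mod Y lem).
move=> /sigma01P[m /haltsP[V cV]]; have /negP := YP (m + V); apply.
apply/bexP; exists m; first by rewrite ltnS leq_addr.
by apply/bexP; exists V; rewrite ?ltnS ?leq_addl// pre_mod// leq_addr.
Qed.

Lemma least_fun (p : nat -> nat -> bool) : (forall n, exists s, p n s) ->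
  exists g, forall n, p n (g n) /\ (forall s, s < g n -> ~~ p n s).
Proof.
move=> exp.
have /choice[g gP] : forall n, exists s, p n s /\ (forall s', s' < s -> ~~ p n s').
  move=> n; case: (ex_minnP (exp n)) => s ps smin; exists s; split=> // s'.
  by apply: contraTN; rewrite -leqNgt; exact: smin.
by exists g.
Qed.

Section LowForRandom.
Variable R : realType.
Local Open Scope ring_scope.

(** The integer form makes the comparison of measures computable. *)
Lemma wt_gap s t K p q :
  (cnt s p * 2 ^ t * 2 ^ K + 2 ^ (s + t) < cnt (s + t) q * 2 ^ K)%N =
  (wt R s p + 2 ^- K < wt R (s + t) q).
Proof.
rewrite -(ltr_nat R) natrD !natrM !natr_exp2.
rewrite -[RHS](ltr_pM2r (_ : 0 < 2 ^+ (s + t) * 2 ^+ K)); last by rewrite mulr_gt0 ?exp2_gt0.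
rewrite /wt; congr (_ < _); rewrite exprD; field; rewrite ?exp2_neq0//.
Qed.

(** 0' finds [g n] such that convergence at [n] after stage [g n] has measure at most 2^-(k+n+2).
    Requiring convergence by stage [g n] for all [n] loses at most 2^-(k+1) of [Tot c]. *)
Lemma pi01_halting_Tot c : ~ null R (Tot c) ->
  exists F, [/\ pi01 halting_problem F, ~ null R F & F `<=` Tot c].
Proof.
move=> /not_null[k ncov].
pose r x t := (cnt (p2 x) (conv c (p1 x) (p2 x)) * 2 ^ t * 2 ^ (k.+1 + p1 x).+1 + 2 ^ (p2 x + t)
  < cnt (p2 x + t) (conv c (p1 x) (p2 x + t)) * 2 ^ (k.+1 + p1 x).+1)%N.
have cr := @halting_decides r ltac:(rewrite /r /conv; comp_tac).
have [|g gP] := @least_fun (fun n s => ~~ `[< exists t, r (pair_nat n s) t >]).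
  move=> n.
  apply: contrapT => /forallNP nex.
  have {}nex s : exists t,
      wt R s (conv c n s) + 2 ^- (k.+1 + n).+1 < wt R (s + t) (conv c n (s + t)).
    have /negP/negPn/asboolP[t] := nex s.
    by rewrite /r p1_pair p2_pair wt_gap; exists t.
  (* Otherwise the measure of convergence by stage [s] would keep growing by a fixed amount and
     exceed 1. *)
  have big m : exists s, m%:R * 2 ^- (k.+1 + n).+1 <= wt R s (conv c n s).
    elim: m => [|m [s ms]]; first by exists 0%N; rewrite mul0r wt_ge0.
    have [t st] := nex s; exists (s + t)%N; apply: le_trans (ltW st).
    by rewrite -natr1 mulrDl mul1r lerD2r.
  have [s] := big (2 ^ (k.+1 + n).+1).+1.
  have := wt1 R s (conv c n s).
  rewrite -natr1 natr_exp2 mulrDl divff ?exp2_neq0// mul1r.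
  have : 0 < 2 ^- (k.+1 + n).+1 :> R by rewrite invr_gt0 exp2_gt0.
  by move=> *; lra.
have cg : comp [set halting_problem] (fun _ => g).
  apply: (comp_mu (r := fun _ n s => ~~ `[< exists t, r (pair_nat n s) t >])).
  - apply: comp_neg; have c2 := comp_comp cr (comp_pair (comp_p1 _) (comp_p2 _)); exact: c2.
  - by move=> _ _ n; exact: (gP n).1.
  - by move=> _ _ n; exact: (gP n).2.
(* The condition for [n] is tested at every length from [maxn n (g n)] on. *)
pose W s j := bex s.+1 (fun n => (g n <= s)%N && ~~ conv c n (g n) (j %% 2 ^ g n)).
pose F := [set Y | forall s, ~~ W s (pre Y s)].
have FP Y : F Y <-> forall n, conv c n (g n) (pre Y (g n)).
  split=> [YF n|YP s].
    have /bexP YFn := YF (maxn n (g n)); apply/negPn/negP => nc; apply: YFn.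
    by exists n; rewrite ?ltnS ?leq_maxl// leq_maxr pre_mod ?leq_maxr.
  by apply/bexP => -[n _ /andP[gs]]; rewrite pre_mod// YP.
have FTot : F `<=` Tot c by move=> Y /FP YP; apply/TotP => n; exists (g n).
exists F; split=> //; first by exists W => //; rewrite /W /conv; comp_tac.
move=> /(_ k.+1) cF; apply: ncov.
have -> : 2 ^- k = 2 ^- k.+1 + 2 ^- k.+1 :> R.
  by rewrite exprS; field; rewrite exp2_neq0.
(* [P n] collects the strings whose convergence at [n] comes only after stage [g n]. *)
pose P n s j := [&& (g n <= s)%N, conv c n s j & ~~ conv c n (g n) (j %% 2 ^ g n)].
apply: cov_sub (covU cF (cov_bigU (A := fun n => [set Y | exists s, P n s (pre Y s)])
    (r := fun n => 2 ^- (k.+1 + n).+1) _ (sum_exp2_le R k.+1))).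
  move=> Y /TotP YT; have [YF|/FP/existsNP[n /negP nc]] := pselect (F Y); first by left.
  right; exists n => //=; have [s sc] := YT n; exists (maxn (g n) s).
  rewrite /P leq_maxl pre_mod ?leq_maxl// nc andbT /=.
  by apply: (conv_mod (leq_maxr (g n) s)); rewrite pre_mod// leq_maxr.
move=> n; apply: cov_open => N.
have [gN|Ng] := leqP (g n) N; last first.
  apply: (@le_trans _ _ 0); last by rewrite invr_ge0 ltW ?exp2_gt0.
  rewrite /wt /cnt /bsum big1 ?mul0r// => j _; case: (boolP (mono _ _ _)) => // /bexP[u].
  by rewrite ltnS /P => uN /andP[gu]; have := leq_trans gu uN; rewrite leqNgt Ng.
apply: (@le_trans _ _ (wt R N (fun j => conv c n N j && ~~ conv c n (g n) (j %% 2 ^ g n)))).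
  apply: wt_sub => j ltj /bexP[u]; rewrite ltnS => uN /and3P[gu cu].
  by rewrite modn_dvdm ?dvdn_exp2l// => ->; rewrite (conv_mod uN cu).
have [/asboolP/forallNP/(_ (N - g n)%N)/negP] := gP n.
rewrite /r p1_pair p2_pair wt_gap subnKC// -leNgt => + _.
rewrite (wtID R N (conv c n N) (fun j => conv c n (g n) (j %% 2 ^ g n)%N)).
suff : wt R (g n) (conv c n (g n)) <=
    wt R N (fun j => conv c n N j && conv c n (g n) (j %% 2 ^ g n)) by lra.
rewrite -(wt_mod R (conv c n (g n)) gN); apply: wt_sub => j _ cj.
by rewrite cj (conv_mod gN cj).
Qed.

(** For each [n], the members of [F] with divergence at [n] form a null closed class. By compactness
    some level [g n] leaves few bad strings, and [B] can find it by counting. *)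
Lemma dominated_of_pi01 c (B : cantor_space) F :
  pi01 B F -> ~ null R F -> null R (F `\` Tot c) ->
  exists f, turing_le f B /\
    (0 < fair_coin R [set X | exists g, computes X c g /\ dominates f g])%E.
Proof.
move=> [W cW FE] /not_null[k ncov] nFT.
pose bad n s j := ~~ mono W s j && ~~ conv c n s j.
have [|g gP] := @least_fun
    (fun n s => (cnt s (bad n s) * 2 ^ (k.+1 + n).+1 <= 2 ^ s)%N).
  move=> n.
  have [||s sP] := @cov_closed R (bad n) (2 ^- (k.+1 + n).+1).
  - move=> s j ltj /andP[nW nc]; apply/andP; split.
      by apply: contra nW; exact: mono_mod.
    by apply: contra nc; exact: conv_mod.
  - apply: cov_sub (nFT _) => X XP; split.
      rewrite FE => s; have /andP[nW _] := XP s; apply: contra nW => Ws.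
      by apply/mono_pre; exists s.
    by move=> /TotP/(_ n)[s sc]; have /andP[_] := XP s; rewrite sc.
  - by exists s; rewrite (wt_nat_le R).
have cg : comp [set B] (fun _ => g).
  apply: (comp_mu (r := fun _ n s => (cnt s (bad n s) * 2 ^ (k.+1 + n).+1 <= 2 ^ s)%N)).
  - by rewrite /bad /conv; comp_tac.
  - by move=> _ _ n; exact: (gP n).1.
  - by move=> _ _ n; exact: (gP n).2.
(* The sum over all strings of length [g n] and all certificates below [g n] stands in for a maximum
   of the certified values. *)
pose f n := bsum (2 ^ g n) (fun j => bsum (g n) (fun V =>
  cert (testbit j) (goedel c) n V * p1 V)%N).
exists f; split.
  have [d dP] : comp [set B] (fun _ => f) by rewrite /f; comp_tac.
  by exists d; exact: dP.
apply/fair_coin_gt0 => nE; apply: ncov.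
(* The summands are for the dominated reals, the part of [F] outside [Tot c], and the reals with a
   bad prefix. *)
have -> : 2 ^- k = (2 ^- k.+2 + 2 ^- k.+2) + 2 ^- k.+1 :> R.
  by rewrite !exprS; field; rewrite exp2_neq0.
apply: cov_sub (covU (covU (nE k.+2) (nFT k.+2))
  (cov_bigU (A := fun n => [set Y | bad n (g n) (pre Y (g n))])
    (r := fun n => 2 ^- (k.+1 + n).+1) _ (sum_exp2_le R k.+1))); last first.
  by move=> n; apply: cov_le (cov_clopen R _ _); rewrite -wt_nat_le; have [] := gP n.
move=> Y FY; have [YT|nYT] := pselect (Tot c Y); last by left; right.
have [[n bn]|/forallNP nbad] := pselect (exists n, bad n (g n) (pre Y (g n))).
  by right; exists n.
left; left; have [v vP] := choice YT; exists v; split=> //; exists 0%N => n _.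
have /negP := nbad n; rewrite /bad negb_and !negbK => /orP[/mono_pre[u _ Wu]|/bexP[V ltV cV]].
  by move: FY; rewrite FE => /(_ u); rewrite Wu.
have /cert_eval/(eval_fun (vP n))-> : cert Y (goedel c) n V.
  by rewrite -(eq_cert _ _ (_ : forall i, (i < V)%N -> testbit (pre Y (g n)) i = Y i))// => i ltiV;
    rewrite testbit_pre// (ltn_trans ltiV).
rewrite /f /bsum (bigD1 (Ordinal (pre_lt Y (g n))))//= (leq_trans _ (leq_addr _ _))//.
by rewrite (bigD1 (Ordinal ltV))//= cV mul1n leq_addr.
Qed.

End LowForRandom.

(** * Forcing with classes of positive measure *)

Section Forcing.
Variable R : realType.
Local Open Scope ring_scope.

(** Otherwise [F] would lie, up to null sets, in the tails of every test member. The index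
    [(a + e).+2] pays for the shift by [a], the strict inequality and the halving of 2^-e. *)
Lemma null_diff_test A c a Z (F : set cantor_space) : ml_test R A c ->
  ~ null R F -> exists k, ~ null R (F `&` [set Y | (~` sigma01 A c k) (glue a Z Y)]).
Proof.
move=> ct nF; apply: contrapT => /forallNP nk; apply: nF => e.
have -> : 2 ^- e = 2 ^- e.+1 + 2 ^+ a * 2 ^- (a + e).+1 :> R.
  by rewrite -addnS exprD exprS; field; rewrite ?exp2_neq0.
have sk : (2 ^- (a + e).+2 : R) < 2 ^- (a + e).+1.
  by rewrite ltf_pV2 ?posrE ?exp2_gt0// ltr_eXn2l ?ltr1n.
apply: cov_sub (covU (contrapT (nk (a + e).+2) e.+1) (cov_shift a (ml_test_cov ct sk))).
move=> Y FY; have [sY|nsY] := pselect (sigma01 A c (a + e).+2 (glue a Z Y)).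
  by right; exists Z.
by left.
Qed.

(** Stage [n] shrinks the class of tails to avoid a member of the test numbered [n], if there is
    one, then appends a minimal string of [W] after which the class is still not null. Minimal
    strings are nonempty, so the prefixes grow to a real. *)
Lemma random_parse (B : cantor_space) W : ~~ W 0%N 0%N ->
  (forall F, pi01 B F -> ~ null R F -> exists a Z,
    first W a (pre Z a) /\ ~ null R [set Y | F (glue a Z Y)]) ->
  exists X b, ml_random R B X /\ forall N, parses W b N X.
Proof.
move=> W0 ext.
(* In a condition [(p, Z, F)] the first [p] bits of [Z] are fixed and [F] is the class of admissible
   tails. *)
pose good (st : nat * cantor_space * set cantor_space) := pi01 B st.2 /\ ~ null R st.2.
pose next n (st st' : nat * cantor_space * set cantor_space) :=
  (exists a Z, [/\ first W a (pre Z a), st'.1 = ((st.1.1 + a)%N, glue st.1.1 st.1.2 Z) &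
     forall Y, st'.2 Y -> st.2 (glue a Z Y)]) /\
  (forall c, goedel c = n -> ml_test R B c ->
     exists k, forall Y, st'.2 Y -> ~ sigma01 B c k (glue st'.1.1 st'.1.2 Y)).
have nextP n st : good st -> exists st', good st' /\ next n st st'.
  case: st => -[p Z0] F [/= F01 nF].
  have [F1 [F101 nF1 F1F F1c]] : exists F1, [/\ pi01 B F1, ~ null R F1, F1 `<=` F &
      forall c, goedel c = n -> ml_test R B c ->
        exists k, forall Y, F1 Y -> ~ sigma01 B c k (glue p Z0 Y)].
    have [[c [cn ct]]|nc] := pselect (exists c, goedel c = n /\ ml_test R B c); last first.
      by exists F; split=> // c cn ct; case: nc; exists c.
    have [k nFk] := null_diff_test p Z0 ct nF.
    exists (F `&` [set Y | (~` sigma01 B c k) (glue p Z0 Y)]); split=> //.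
    - by apply: pi01I => //; apply: pi01_glue; exact: pi01_sigma01.
    - by move=> d; rewrite -cn => /goedel_inj -> _; exists k => Y [].
  have [a [Z [fZ nZ]]] := ext F1 F101 nF1.
  exists ((p + a)%N, glue p Z0 Z, [set Y | F1 (glue a Z Y)]); split.
    by split=> //; exact: pi01_glue.
  split; first by exists a, Z; split=> // Y /F1F.
  by move=> c cn ct; have [k kP] := F1c c cn ct; exists k => Y /= /kP; rewrite glue_glue.
pose T := {st | good st}.
have /choice[nx nxP] : forall u : nat * T, exists v : T, next u.1 (sval u.2) (sval v).
  move=> [n [st stg]]; have [st' [gst' nst']] := nextP n st stg.
  by exists (exist _ st' gst').
have good0 : good (0%N, point, setT).
  split; last by move=> /(_ 1%N)/covT_ge1; rewrite expr1; lra.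
  exists (fun _ _ => false); first exact: comp_const.
  by apply/seteqP; split.
pose st := fix st n : T := if n is n'.+1 then nx (n', st n') else exist _ _ good0.
pose b n := (sval (st n)).1.1; pose Z n := (sval (st n)).1.2; pose F n := (sval (st n)).2.
have stS n : exists a Z1, [/\ first W a (pre Z1 a), b n.+1 = (b n + a)%N,
    Z n.+1 = glue (b n) (Z n) Z1 & forall Y, F n.+1 Y -> F n (glue a Z1 Y)].
  have [[a [Z1 [fZ e FF]]] _] := nxP (n, st n).
  by exists a, Z1; split=> //; [rewrite /b /= e|rewrite /Z /= e].
have bS n : (b n < b n.+1)%N.
  have [a [Z1 [/andP[Wa _] -> _ _]]] := stS n.
  by case: a Wa => [|a _]; rewrite ?addnS ?ltnS ?leq_addr// /pre bsum0 (negbTE W0).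
have leb n : (n <= b n)%N.
  by elim: n => // n IHn; exact: leq_ltn_trans (bS n).
have Zm n m i : (n <= m)%N -> (i < b n)%N -> Z m i = Z n i /\ (i < b m)%N.
  move=> /subnKC <-; elim: (m - n)%N => [|d IHd] lti; first by rewrite addn0.
  have [<- ltd] := IHd lti; rewrite addnS; have [a [Z1 [_ -> -> _]]] := stS (n + d)%N.
  by rewrite /glue ltd ltn_addr.
(* Bit [i] is settled at stage [i.+1], because [n <= b n]. *)
pose X : cantor_space := fun i => Z i.+1 i.
have XZ n i : (i < b n)%N -> X i = Z n i.
  move=> lti; rewrite /X.
  have [<- _] := Zm n (maxn n i.+1) i (leq_maxl _ _) lti.
  by have [<- _] := Zm i.+1 (maxn n i.+1) i (leq_maxr _ _) (leb i.+1).
exists X, b; split; last first.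
  move=> N; split=> // i _; rewrite (ltnW (bS i)) /=.
  have [a [Z1 [fZ e eZ _]]] := stS i; rewrite e addKn.
  have -> // : pre (cut (b i) X) a = pre Z1 a.
  apply: eq_pre => j ltj; rewrite /cut (XZ i.+1) ?e ?ltn_add2l//.
  by rewrite eZ /glue ltnNge leq_addr /= addKn.
move=> c ct /(_ _ I) Xc.
have [_ /(_ c erefl ct)[k]] := nxP (goedel c, st (goedel c)).
set n := (goedel c).+1; rewrite -[nx _]/(st n) => kP.
have kPm m : (n <= m)%N -> forall Y, F m Y -> ~ sigma01 B c k (glue (b m) (Z m) Y).
  move=> /subnKC <-; elim: (m - n)%N => [|d IHd] Y; first by rewrite addn0; exact: kP.
  rewrite addnS; have [a [Z1 [_ -> -> FF]]] := stS (n + d)%N.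
  by move=> /FF /IHd; rewrite glue_glue.
have /sigma01P[L hL] := Xc k.
(* A late class is not null, hence has a member; it continues a prefix of [X] of length at least [L]
   and still avoids the open class. *)
have [Y FY] : exists Y, F (maxn n L) Y.
  apply: contrapT => /forallNP nY; have [_] := svalP (st (maxn n L)); apply.
  by apply: null_sub (null0 R) => Y /nY.
apply: (kPm _ (leq_maxl n L) Y FY); apply/sigma01P; exists L.
rewrite (_ : pre _ L = pre X L)//; apply: eq_pre => i ltiL.
have ltib : (i < b (maxn n L))%N.
  by apply: leq_trans (leb _); rewrite leq_max ltiL orbT.
by rewrite /glue ltib -XZ.
Qed.

Lemma low_dominating (B : cantor_space) :
  low_for_random R halting_problem B -> positive_measure_dominating R B.
Proof.
move=> low c; have [/fair_coin_null|nTot] := pselect (null R (Tot c)); first by right.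
left; apply: contrapT => ndom.
have [_ [[W cW ->] nG GTot]] := pi01_halting_Tot nTot.
have W0 : ~~ W 0%N 0%N.
  apply/negP => W0; apply: nG; apply: null_sub (null0 R) => Y /(_ 0%N).
  by rewrite /pre bsum0 W0.
have [|X [b [rX pX]]] := @random_parse B W W0; last first.
  exact: parses_not_random cW nG pX (low X rX).
move=> F F01 nF; apply: contrapT => next; apply: ndom.
apply: dominated_of_pi01 F01 nF _.
(* A real of [F] outside [Tot c] has a minimal prefix in [W], so [F] minus [Tot c] splits along
   these countably many prefixes. Behind each of them [F] is null, as otherwise the extension sought
   would exist. *)
apply: null_sub (null_bigU (A := fun z =>
    [set Y | first W (p1 z) (p2 z) /\ pre Y (p1 z) = p2 z /\ F Y]) _).
  move=> Y [FY nYT]; have [|s fs] := @first_ex W Y.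
    apply: contrapT => /forallNP nW; apply/nYT/GTot => s; exact/negP.
  by exists (pair_nat s (pre Y s)) => //=; rewrite p1_pair p2_pair.
(* A pair codes a string only if its second component is below 2 to the power of the first. *)
move=> z; have [[fz ltz]|nz] := pselect (first W (p1 z) (p2 z) /\ (p2 z < 2 ^ p1 z)%N).
  apply: null_sub (null_prefix (Z := testbit (p2 z)) (A := F) (a := p1 z) _).
    by move=> Y [_ [YZ FY]]; split=> //; rewrite pre_testbit modn_small.
  apply: contrapT => nn; apply: next; exists (p1 z), (testbit (p2 z)).
  by rewrite pre_testbit modn_small.
apply: null_sub (null0 R) => Y [fz [YZ _]]; apply: nz; split=> //.
by rewrite -YZ pre_lt.
Qed.

End Forcing.

Theorem theorem3p2 (R : realType) (B : cantor_space) :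
  low_for_random R halting_problem B <-> positive_measure_dominating R B.
Proof. by split; [exact: low_dominating | exact: dominating_low]. Qed.
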